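(* Let $\varsigma\in L^\infty(\mathbb{Z}^n\times\mathbb{T}^n)$ and $g_1,g_2\in M^1(\mathbb{Z}^n)$. Then the localization operator $\mathfrak{L}^{g_1,g_2}_\varsigma$ is in $\mathcal{B}(\ell^2(\mathbb{Z}^n))$ and $$\|\mathfrak{L}^{g_1,g_2}_\varsigma\|_{\mathcal{B}(\ell^2(\mathbb{Z}^n))}\le\|\varsigma\|_{L^\infty(\mathbb{Z}^n\times\mathbb{T}^n)}\,\|g_1\|_{M^1(\mathbb{Z}^n)}\,\|g_2\|_{M^1(\mathbb{Z}^n)}.$$
   Context: $\mathbb{T}^n$ is the torus with normalized Haar measure $dw$; $\mathbb{Z}^n\times\mathbb{T}^n$ carries the product of counting measure and $dw$. $T_mf(k)=f(k-m)$, $M_wf(k)=e^{2\pi i w\cdot k}f(k)$, and the short-time Fourier transform is $V_gf(m,w)=\langle f,M_wT_mg\rangle=\sum_{k\in\mathbb{Z}^n}f(k)\overline{g(k-m)}e^{-2\pi i w\cdot k}$. $\mathcal{S}(\mathbb{Z}^n)$ is the space of rapidly decreasing functions on $\mathbb{Z}^n$ and $\mathcal{S}'(\mathbb{Z}^n)$ its dual (tempered distributions). Modulation space: fix a non-zero window $g\in\mathcal{S}(\mathbb{Z}^n)$; for $1\le p\le\infty$, $M^p(\mathbb{Z}^n)=\{f\in\mathcal{S}'(\mathbb{Z}^n): V_gf\in L^p(\mathbb{Z}^n\times\mathbb{T}^n)\}$ with $\|f\|_{M^p(\mathbb{Z}^n)}=\|V_gf\|_{L^p(\mathbb{Z}^n\times\mathbb{T}^n)}$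 (different windows give equivalent norms). Localization operator: $\mathfrak{L}^{g_1,g_2}_\varsigma f(k)=\sum_{m\in\mathbb{Z}^n}\int_{\mathbb{T}^n}\varsigma(m,w)V_{g_1}f(m,w)\,M_wT_mg_2(k)\,dw$, or in the weak sense $$\langle\mathfrak{L}^{g_1,g_2}_\varsigma f,h\rangle_{\ell^2(\mathbb{Z}^n)}=\sum_{m\in\mathbb{Z}^n}\int_{\mathbb{T}^n}\varsigma(m,w)\,V_{g_1}f(m,w)\,\overline{V_{g_2}h(m,w)}\,dw,\qquad f,h\in\ell^2(\mathbb{Z}^n).$$ $\mathcal{B}(X)$ denotes the bounded linear operators on $X$ with operator norm.
   Formalization: The bound with constant 1 fails for small windows (symbol 1, g1=g2=δ_0, g=εδ_0); what is proved, for every non-zero window g, is boundedness and the inequality with left side multiplied by ‖g‖_2^2, hence the stated inequality when ‖g‖_2=1. *)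

(* Defs.v *)
From HB Require Import structures.
From mathcomp Require Import all_boot all_order all_algebra.
From mathcomp Require Import all_classical all_reals all_analysis.
From mathcomp.real_closed Require Import complex.

Set Implicit Arguments.
Unset Strict Implicit.
Unset Printing Implicit Defensive.
Import Order.TTheory GRing.Theory Num.Theory.
Import numFieldNormedType.Exports.

Local Open Scope classical_set_scope.
Local Open Scope ring_scope.
Local Open Scope complex_scope.

Definition Zn (n : nat) : Type := 'rV[int]_n.

HB.instance Definition _ n := GRing.Zmodule.on (Zn n).
HB.instance Definition _ n := Countable.on (Zn n).
HB.instance Definition _ n := isPointed.Build (Zn n) 0.
HB.instance Definition _ n := @isMeasurable.Build default_measure_display
  (Zn n) discrete_measurable discrete_measurable0
  discrete_measurableC discrete_measurableU.

(* T^n is the measure space R^n with the product of n copies of the uniform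
   probability on the fundamental domain [0, 1]; values of functions outside
   [0, 1]^n are irrelevant almost everywhere. *)
Notation Tn R n := (n.-tuple (measurableTypeR R)) (only parsing).

Section torus_measure.
Context (R : realType).

Definition torus_cons n (p : measurableTypeR R * Tn R n) : Tn R n.+1 :=
  [the n.+1.-tuple (measurableTypeR R) of p.1 :: p.2].

Lemma measurable_torus_cons n : measurable_fun [set: _] (@torus_cons n).
Proof. by apply: measurable_cons. Qed.

HB.instance Definition _ n :=
  isMeasurableFun.Build _ _ _ _ (@torus_cons n) (@measurable_torus_cons n).

(* Normalized Haar measure dw. *)
Fixpoint haar (n : nat) : probability (Tn R n) R :=
  match n with
  | 0 => dirac ([tuple] : Tn R 0)
  | n'.+1 => distribution (uniform_prob (@ltr01 R) \x haar n')%E (@torus_cons n')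
  end.

End torus_measure.

Section complex_integration.
Context d (T : measurableType d) (R : realType).
Variable mu : {measure set T -> \bar R}.
Implicit Types (p : \bar R) (f : T -> R[i]).

Definition cabs (z : R[i]) : R := Normc.normc z.

Definition cintegral f : R[i] :=
  (\int[mu]_x complex.Re (f x)) +i* (\int[mu]_x complex.Im (f x)).

Definition cmeasurable f : Prop :=
  measurable_fun setT ((@complex.Re R) \o f) /\ measurable_fun setT ((@complex.Im R) \o f).

Definition LpNorm p f : \bar R := ('N[mu]_p[EFin \o (cabs \o f)])%E.

Definition Lp p f : Prop := cmeasurable f /\ (LpNorm p f < +oo)%E.

End complex_integration.

Section time_frequency.
Context (R : realType) (n : nat).
Local Notation C := R[i].

Definition countZ : {measure set (Zn n) -> \bar R} := @counting (Zn n) R.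

(* The product of counting measure and dw on Z^n x T^n. *)
Definition phase_measure : {measure set (Zn n * Tn R n) -> \bar R} :=
  (countZ \x haar R n)%E.

(* Unordered (absolutely convergent) sum over Z^n. *)
Definition csum (f : Zn n -> C) : C := cintegral countZ f.

(* <f, h> = sum_k f(k) conj(h(k)). *)
Definition pairing (f h : Zn n -> C) : C := csum (fun k => f k * (h k)^*).

Definition dot (w : Tn R n) (k : Zn n) : R :=
  \sum_(i < n) tnth w i * (k 0 i)%:~R.

Definition translate (m : Zn n) (f : Zn n -> C) : Zn n -> C :=
  fun k => f (k - m).

Definition modulate (w : Tn R n) (f : Zn n -> C) : Zn n -> C :=
  fun k => (cos (2 * pi * dot w k) +i* sin (2 * pi * dot w k)) * f k.

Definition stft (g f : Zn n -> C) (mw : Zn n * Tn R n) : C :=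
  pairing f (modulate mw.2 (translate mw.1 g)).

Definition weight (k : Zn n) : R :=
  1 + Num.sqrt (\sum_(i < n) (k 0 i)%:~R ^+ 2).

Definition schwartz (phi : Zn n -> C) : Prop :=
  forall N : nat, exists M : R, forall k, weight k ^+ N * cabs (phi k) <= M.

Definition schwartz_seminorm (N : nat) (phi : Zn n -> C) : R :=
  sup (range (fun k => weight k ^+ N * cabs (phi k))).

(* Elements of S'(Z^n), as functions on Z^n: those f for which
   phi |-> sum_k f(k) phi(k) is a well-defined functional on S(Z^n), continuous
   for the seminorms above (which increase with N). Every continuous linear
   functional u on S(Z^n) is of this form, with f(k) = u(delta_k). *)
Definition tempered (f : Zn n -> C) : Prop :=
  (forall phi, schwartz phi -> Lp countZ 1%E (fun k => f k * phi k)) /\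
  exists (N : nat) (M : R), forall phi, schwartz phi ->
    cabs (csum (fun k => f k * phi k)) <= M * schwartz_seminorm N phi.

(* The M^p norm scales with the window g; an inequality linear in each modNorm
   therefore carries a compensating power of the l^2 norm of g, which is 1 for
   a normalized window. *)
Definition modNorm (g : Zn n -> C) (p : \bar R) (f : Zn n -> C) : \bar R :=
  LpNorm phase_measure p (stft g f).

Definition modSpace (g : Zn n -> C) (p : \bar R) (f : Zn n -> C) : Prop :=
  tempered f /\ Lp phase_measure p (stft g f).

Definition l2 (f : Zn n -> C) : Prop := Lp countZ 2%:E f.

Definition l2norm (f : Zn n -> C) : \bar R := LpNorm countZ 2%:E f.

Definition locop (sigma : Zn n * Tn R n -> C) (g1 g2 f : Zn n -> C) :
    Zn n -> C := fun k =>
  csum (fun m => cintegral (haar R n) (fun w =>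
    sigma (m, w) * stft g1 f (m, w) * modulate w (translate m g2) k)).

(* Membership in B(l^2) of (the restriction to l^2 of) T. *)
Definition bounded_l2 (T : (Zn n -> C) -> (Zn n -> C)) : Prop :=
  [/\ forall f, l2 f -> l2 (T f),
      forall (a : C) f h, l2 f -> l2 h ->
        T (fun k => a * f k + h k) = (fun k => a * T f k + T h k) &
      exists M : R, forall f, l2 f -> (l2norm (T f) <= M%:E * l2norm f)%E].

Definition opnorm_l2 (T : (Zn n -> C) -> (Zn n -> C)) : \bar R :=
  ereal_sup [set l2norm (T f) | f in [set f | l2 f /\ (l2norm f <= 1)%E]].

End time_frequency.

(* Main.v *)
From HB Require Import structures.
Require Import Defs.
From mathcomp Require Import all_boot all_order all_algebra finmap.
From mathcomp Require Import all_classical all_reals all_analysis.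
From mathcomp.real_closed Require Import complex.
From mathcomp Require Import measurable_realfun ess_sup_inf ring lra.

(** The short-time Fourier transform [V_g f(m, .)] at time shift [m] is the absolutely
    convergent Fourier series with coefficients [f(k) conj(g(k - m))]. Everything follows
    from three facts about such series: the coefficient bound [|c_k| <= ||F||_1], Parseval's
    identity [||F||_2^2 = sum_k |c_k|^2] and Bessel's inequality. They are proved for an
    abstract orthonormal system of unimodular functions on a probability space
    ([coef_le_norm1], [parseval], [bessel]); the characters of the torus form such a system
    ([char_orthonormal]).

    Norm of the operator. Let [S] be the essential sup norm of the symbol, and let [b_m(k)] be the
    [k]-th Fourier coefficient of [sigma(m, .) V_{g1} f(m, .)], so that
    [L f(k) = sum_m g2(k - m) b_m(k)]. By Cauchy-Schwarz in [m],
    [|L f(k)|^2 <= ||g2||^2 sum_m |b_m(k)|^2]. Summing over [k], exchanging the sums and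
    applying Bessel for each [m] gives
    [||L f||^2 <= ||g2||^2 S^2 sum_m ||V_{g1} f(m, .)||_2^2], and the last sum is
    [||f||^2 ||g1||^2] by Moyal's identity ([moyal]), which is Parseval for each [m]. Hence
    [||L|| <= S ||g1||_2 ||g2||_2] ([locop_norm2]).

    From the 2-norm to the modulation norm. It remains to see that
    [||g||_2 ||f||_2 <= ||V_g f||_1] for [f] in the modulation space [M^1]
    ([l2norm_window_le]). With [A(m) = ||V_g f(m, .)||_1], the coefficient bound reads
    [|f(k) g(k - m)| <= A(m)]. Fixing a point where [g] does not vanish and summing shows
    that [f] is summable, and symmetrically [g] is summable unless [f = 0]. Then
    [||f||^2 ||g||^2 = sum_m sum_k |f(k) g(k - m)|^2
      <= sum_m A(m) sum_k |f(k) g(k - m)| <= ||V_g f||_1 ||f|| ||g||],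
    and one factor [||f|| ||g||] cancels. The power [||g||^2] in the final estimate comes
    from using this once for [g1] and once for [g2]. *)

Set Implicit Arguments.
Unset Strict Implicit.
Unset Printing Implicit Defensive.
Import Order.TTheory GRing.Theory Num.Theory.
Import numFieldNormedType.Exports.

Local Open Scope classical_set_scope.
Local Open Scope ring_scope.

(** * Integrals of complex functions *)

Section complex_numbers.
Context (R : realType).
Implicit Types z y : R[i].

Lemma ReM z y : complex.Re (z * y) = complex.Re z * complex.Re y - complex.Im z * complex.Im y.
Proof. by case: z => a b; case: y. Qed.

Lemma ImM z y : complex.Im (z * y) = complex.Re z * complex.Im y + complex.Im z * complex.Re y.
Proof. by case: z => a b; case: y. Qed.

Lemma ReD z y : complex.Re (z + y) = complex.Re z + complex.Re y.
Proof. by case: z => a b; case: y. Qed.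

Lemma ImD z y : complex.Im (z + y) = complex.Im z + complex.Im y.
Proof. by case: z => a b; case: y. Qed.

Lemma complex_ext z y :
  complex.Re z = complex.Re y -> complex.Im z = complex.Im y -> z = y.
Proof. by case: z => a b; case: y => c d /= -> ->. Qed.

Lemma cabsE z :
  cabs z = Num.sqrt (complex.Re z ^+ 2 + complex.Im z ^+ 2).
Proof. by case: z. Qed.

Lemma sqr_cabs z : cabs z ^+ 2 = complex.Re z ^+ 2 + complex.Im z ^+ 2.
Proof. by rewrite cabsE sqr_sqrtr// addr_ge0 ?sqr_ge0. Qed.

Lemma cabs_ge0 z : 0 <= cabs z.
Proof. by rewrite cabsE sqrtr_ge0. Qed.

Lemma cabsM z y : cabs (z * y) = cabs z * cabs y.
Proof. exact: Normc.normcM. Qed.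

Lemma cabs_conj z : cabs (z^*) = cabs z.
Proof. by case: z => a b; rewrite !cabsE /= sqrrN. Qed.

Lemma cabs0 : cabs (0 : R[i]) = 0.
Proof. by rewrite cabsE /= expr0n addr0 sqrtr0. Qed.

Lemma cabs_gt0 z : z <> 0 -> 0 < cabs z.
Proof.
move=> z0; rewrite lt_neqAle cabs_ge0 andbT eq_sym; apply/eqP.
by move/Normc.eq0_normc.
Qed.

Lemma normr_Re z : `|complex.Re z| <= cabs z.
Proof. by rewrite cabsE -sqrtr_sqr ler_wsqrtr// lerDl sqr_ge0. Qed.

Lemma normr_Im z : `|complex.Im z| <= cabs z.
Proof. by rewrite cabsE -sqrtr_sqr ler_wsqrtr// lerDr sqr_ge0. Qed.

Lemma sqr_cabsD_le z y : cabs (z + y) ^+ 2 <= 2 * cabs z ^+ 2 + 2 * cabs y ^+ 2.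
Proof.
rewrite !sqr_cabs ReD ImD.
have := sqr_ge0 (complex.Re z - complex.Re y).
have := sqr_ge0 (complex.Im z - complex.Im y); rewrite !expr2; lra.
Qed.

Lemma mulr_conj z : z * z^* = (cabs z ^+ 2)%:C%C.
Proof.
by rewrite sqr_cabs; case: z => a b; apply: complex_ext; rewrite ?ReM ?ImM /=; ring.
Qed.

End complex_numbers.

Section nonnegative_extended_reals.
Context (R : realType).
Local Open Scope ereal_scope.
Implicit Types x y : \bar R.

Lemma expe2_ge0 x : 0 <= x ^+ 2.
Proof. by rewrite expe2 sqre_ge0. Qed.

Lemma lee_expe2 x y : 0 <= x -> x <= y -> x ^+ 2 <= y ^+ 2.
Proof. by move=> x0 xy; rewrite !expe2 lee_pmul. Qed.

Lemma expe2M x y : (x * y) ^+ 2 = x ^+ 2 * y ^+ 2.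
Proof. by rewrite !expe2 muleACA. Qed.

Lemma expe2_le x y : 0 <= x -> 0 <= y -> x ^+ 2 <= y ^+ 2 -> x <= y.
Proof.
move: x y => [x| |] [y| |]//; rewrite ?leey//.
by rewrite !expe2 -!EFinM !lee_fin -!expr2 => x0 y0; rewrite ler_pXn2r.
Qed.

Lemma expe2_lty x : x < +oo -> 0 <= x -> x ^+ 2 < +oo.
Proof. by move: x => [x| |]// _ _; rewrite expe2 -EFinM ltry. Qed.

Lemma lty_expe2 x : 0 <= x -> x ^+ 2 < +oo -> x < +oo.
Proof. by move: x => [x| |]// _; rewrite ?ltry// expe2 mulyy. Qed.

Lemma poweR2 x : 0 <= x -> x `^ 2 = x ^+ 2.
Proof.
move: x => [x| |]//; rewrite expe2 => x0; last by rewrite poweRyr// mulyy.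
by rewrite poweR_EFin powR_mulrn// expr2 EFinM.
Qed.

End nonnegative_extended_reals.

Section cmeasurable.
Context d (T : measurableType d) (R : realType).
Implicit Types f h : T -> R[i].

Lemma cmeasurable_cst (z : R[i]) : cmeasurable (fun _ : T => z).
Proof. by split; exact: measurable_cst. Qed.

Lemma cmeasurableM f h :
  cmeasurable f -> cmeasurable h -> cmeasurable (fun x => f x * h x).
Proof.
move=> [fr fi] [hr hi]; split.
- rewrite (_ : _ \o _ = ((@complex.Re R \o f) \* (@complex.Re R \o h)) \-
     ((@complex.Im R \o f) \* (@complex.Im R \o h)))%R; last first.
    by apply/funext => x /=; rewrite ReM.
  by apply: measurable_funB; exact: measurable_funM.
- rewrite (_ : _ \o _ = ((@complex.Re R \o f) \* (@complex.Im R \o h)) \+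
     ((@complex.Im R \o f) \* (@complex.Re R \o h)))%R; last first.
    by apply/funext => x /=; rewrite ImM.
  by apply: measurable_funD; exact: measurable_funM.
Qed.

Lemma cmeasurable_conj f : cmeasurable f -> cmeasurable (fun x => (f x)^*).
Proof.
move=> [fr fi]; split.
  by rewrite (_ : _ \o _ = @complex.Re R \o f)//; apply/funext => x /=; case: (f x).
rewrite (_ : _ \o _ = (fun x => - complex.Im (f x))%R); last first.
  by apply/funext => x /=; case: (f x).
exact: measurableT_comp.
Qed.

Lemma measurable_cabs f : cmeasurable f ->
  measurable_fun setT (fun x => cabs (f x)).
Proof.
move=> [fr fi].
rewrite (_ : (fun x => _) = (fun x => Num.sqrt x)%R \o
   (fun x => complex.Re (f x) ^+ 2 + complex.Im (f x) ^+ 2)%R); last first.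
  by apply/funext => x /=; rewrite cabsE.
apply: measurableT_comp.
  by apply: continuous_measurable_fun; exact: sqrt_continuous.
by apply: measurable_funD; exact: measurable_funX.
Qed.

Lemma measurable_ecabs f : cmeasurable f ->
  measurable_fun setT (fun x => (cabs (f x))%:E).
Proof. by move=> mf; apply/measurable_EFinP; exact: measurable_cabs. Qed.

Lemma measurable_ecabs2 f : cmeasurable f ->
  measurable_fun setT (fun x => (cabs (f x) ^+ 2)%:E).
Proof.
by move=> mf; apply/measurable_EFinP; apply: measurable_funX; exact: measurable_cabs.
Qed.

End cmeasurable.

Section complex_integral.
Context d (T : measurableType d) (R : realType).
Variable mu : {measure set T -> \bar R}.
Implicit Types f h : T -> R[i].

Lemma LpNorm1E f : LpNorm mu 1%E f = (\int[mu]_x (cabs (f x))%:E)%E.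
Proof.
rewrite /LpNorm Lnorm1; apply: eq_integral => x _ /=.
by rewrite ger0_norm// cabs_ge0.
Qed.

Lemma LpNorm2E f : (LpNorm mu 2%:E f ^+ 2 = \int[mu]_x (cabs (f x) ^+ 2)%:E)%E.
Proof.
rewrite /LpNorm -poweR2 ?Lnorm_ge0// poweR_Lnorm//.
apply: eq_integral => x _ /=.
by rewrite ger0_norm ?cabs_ge0// powR_mulrn// cabs_ge0.
Qed.

Lemma Lp1_Re f : Lp mu 1%E f -> mu.-integrable setT (EFin \o (@complex.Re R \o f)).
Proof.
move=> [mf]; rewrite LpNorm1E => fi; apply/integrableP; split.
  by apply/measurable_EFinP; case: mf.
apply: le_lt_trans fi; apply: ge0_le_integral => //.
- by apply/measurable_EFinP/measurableT_comp => //; case: mf.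
- exact: measurable_ecabs.
- by move=> x _; rewrite lee_fin; exact: normr_Re.
Qed.

Lemma Lp1_Im f : Lp mu 1%E f -> mu.-integrable setT (EFin \o (@complex.Im R \o f)).
Proof.
move=> [mf]; rewrite LpNorm1E => fi; apply/integrableP; split.
  by apply/measurable_EFinP; case: mf.
apply: le_lt_trans fi; apply: ge0_le_integral => //.
- by apply/measurable_EFinP/measurableT_comp => //; case: mf.
- exact: measurable_ecabs.
- by move=> x _; rewrite lee_fin; exact: normr_Im.
Qed.

Lemma eq_cintegral f h : f =1 h -> cintegral mu f = cintegral mu h.
Proof. by move=> /funext ->. Qed.

Lemma cintegralD f h : Lp mu 1%E f -> Lp mu 1%E h ->
  cintegral mu (fun x => f x + h x) = cintegral mu f + cintegral mu h.
Proof.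
move=> Lf Lh; apply: complex_ext.
- rewrite ReD /= -RintegralD//; [|exact: Lp1_Re|exact: Lp1_Re].
  by apply: eq_Rintegral => x _; rewrite ReD.
- rewrite ImD /= -RintegralD//; [|exact: Lp1_Im|exact: Lp1_Im].
  by apply: eq_Rintegral => x _; rewrite ImD.
Qed.

Let integrableZ (r : R) (u : T -> R) : mu.-integrable setT (EFin \o u) ->
  mu.-integrable setT (EFin \o (fun x => r * u x)).
Proof.
move=> iu; rewrite (_ : EFin \o _ = fun x => r%:E * (EFin \o u) x)%E//.
exact: integrableZl.
Qed.

Lemma cintegralZ (a : R[i]) f : Lp mu 1%E f ->
  cintegral mu (fun x => a * f x) = a * cintegral mu f.
Proof.
move=> Lf; have ir := Lp1_Re Lf; have ii := Lp1_Im Lf; apply: complex_ext.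
- rewrite ReM /= -!RintegralZl// -RintegralB//; [|exact: integrableZ..].
  by apply: eq_Rintegral => x _; rewrite ReM.
- rewrite ImM /= -!RintegralZl// -RintegralD//; [|exact: integrableZ..].
  by apply: eq_Rintegral => x _; rewrite ImM.
Qed.

Lemma Lp1Z (a : R[i]) f : Lp mu 1%E f -> Lp mu 1%E (fun x => a * f x).
Proof.
rewrite /Lp !LpNorm1E => -[mf fi]; split.
  by apply: cmeasurableM => //; exact: cmeasurable_cst.
under eq_integral do rewrite cabsM EFinM.
rewrite ge0_integralZl ?lee_fin ?cabs_ge0//.
- by apply: lte_mul_pinfty => //; rewrite lee_fin cabs_ge0.
- exact: measurable_ecabs.
- by move=> x _; rewrite lee_fin cabs_ge0.
Qed.

Lemma Lp1_boundedM (v f : T -> R[i]) (b : R) : cmeasurable v ->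
  (forall x, cabs (v x) <= b) -> Lp mu 1%E f -> Lp mu 1%E (fun x => v x * f x).
Proof.
move=> mv vb; rewrite /Lp !LpNorm1E => -[mf fi].
split; first exact: cmeasurableM.
apply: (@le_lt_trans _ _ (\int[mu]_x (`|b|%:E * (cabs (f x))%:E))%E).
  apply: ge0_le_integral => //.
  - by move=> x _; rewrite lee_fin cabs_ge0.
  - by apply: measurable_ecabs; exact: cmeasurableM.
  - by apply: emeasurable_funM => //; exact: measurable_ecabs.
  - move=> x _; rewrite -EFinM lee_fin cabsM ler_wpM2r ?cabs_ge0//.
    exact: le_trans (vb x) (ler_norm _).
rewrite ge0_integralZl//.
- exact: lte_mul_pinfty.
- exact: measurable_ecabs.
- by move=> x _; rewrite lee_fin cabs_ge0.
Qed.

Lemma cintegral_conj f : Lp mu 1%E f ->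
  cintegral mu (fun x => (f x)^*) = (cintegral mu f)^*.
Proof.
move=> Lf; apply: complex_ext => /=.
  by apply: eq_Rintegral => x _; case: (f x).
rewrite -mulN1r -RintegralZl//; last exact: Lp1_Im.
by apply: eq_Rintegral => x _; rewrite mulN1r; case: (f x).
Qed.

(** Rotating the integrand by the phase of its integral makes the integral real. *)
Lemma cabs_cintegral f : Lp mu 1%E f ->
  ((cabs (cintegral mu f))%:E <= \int[mu]_x (cabs (f x))%:E)%E.
Proof.
move=> Lf; set z := cintegral mu f; have [mf fi] := Lf.
rewrite LpNorm1E in fi.
have I0 : (0 <= \int[mu]_x (cabs (f x))%:E)%E.
  by apply: integral_ge0 => x _; rewrite lee_fin cabs_ge0.
have Ifin : (\int[mu]_x (cabs (f x))%:E)%E \is a fin_num by rewrite ge0_fin_numE.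
have [->|z0] := eqVneq (cabs z) 0; first exact: I0.
have zp : 0 < cabs z by rewrite lt_neqAle eq_sym z0 cabs_ge0.
have Lz := Lp1Z z^* Lf.
suff : ((cabs z ^+ 2)%:E <= (cabs z)%:E * \int[mu]_x (cabs (f x))%:E)%E.
  by rewrite -(fineK Ifin) -EFinM !lee_fin expr2 ler_pM2l.
have -> : cabs z ^+ 2 = complex.Re (cintegral mu (fun x => z^* * f x)).
  by rewrite cintegralZ// mulrC mulr_conj.
rewrite /= fineK; last exact: integrable_fin_num (Lp1_Re Lz).
have mc := measurable_ecabs mf.
have c0 x : [set: T] x -> (0 <= (cabs (f x))%:E)%E by rewrite lee_fin cabs_ge0.
rewrite -ge0_integralZl ?lee_fin ?cabs_ge0//.
apply: le_integral => //.
- exact: Lp1_Re Lz.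
- apply/integrableP; split; first exact: emeasurable_funM.
  under eq_integral do rewrite gee0_abs ?mule_ge0 ?lee_fin ?cabs_ge0//.
  rewrite ge0_integralZl ?lee_fin ?cabs_ge0//.
  by apply: lte_mul_pinfty => //; rewrite lee_fin cabs_ge0.
- move=> x _; rewrite -EFinM lee_fin.
  apply: (le_trans (ler_norm _)); apply: (le_trans (normr_Re _)).
  by rewrite cabsM cabs_conj.
Qed.

(** Stated for squares, so that infinite values need no separate treatment. *)
Lemma cauchy_schwarz (u v : T -> R) :
  measurable_fun setT u -> measurable_fun setT v ->
  ((\int[mu]_x (`|u x| * `|v x|)%:E) ^+ 2 <=
     (\int[mu]_x (u x ^+ 2)%:E) * (\int[mu]_x (v x ^+ 2)%:E))%E.
Proof.
move=> mu_ mv.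
have sq (w : T -> R) :
    (\int[mu]_x (w x ^+ 2)%:E = (Lnorm mu 2%:E (EFin \o w)) ^+ 2)%E.
  rewrite -poweR2 ?Lnorm_ge0// poweR_Lnorm//.
  by apply: eq_integral => x _ /=; rewrite powR_mulrn// real_normK// num_real.
rewrite !sq -expe2M; apply: lee_expe2.
  by apply: integral_ge0 => x _; rewrite lee_fin mulr_ge0.
have := @hoelder _ T R mu u v 2 2 mu_ mv ltac:(by []) ltac:(by [])
  ltac:(by lra).
rewrite Lnorm1; congr (_ <= _)%E; apply: eq_integral => x _ /=.
by rewrite normrM.
Qed.

End complex_integral.

Section complex_fubini.
Context d1 d2 (T1 : measurableType d1) (T2 : measurableType d2) (R : realType).
Variable m1 : {sigma_finite_measure set T1 -> \bar R}.
Variable m2 : {sigma_finite_measure set T2 -> \bar R}.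
Variable f : T1 -> T2 -> R[i].
(* Every slice, and not only almost every one, is assumed to be integrable: then the
   real-valued inner integrals agree with the extended real ones at every point. *)
Hypothesis mf : cmeasurable (fun z : T1 * T2 => f z.1 z.2).
Hypothesis f1 : forall x, Lp m2 1%E (f x).
Hypothesis f2 : forall y, Lp m1 1%E (f ^~ y).
Hypothesis foo : (\int[m1]_x \int[m2]_y (cabs (f x y))%:E < +oo)%E.

Let integrable_part (p : R[i] -> R) : (forall z, `|p z| <= cabs z) ->
  measurable_fun setT (p \o (fun z : T1 * T2 => f z.1 z.2)) ->
  (m1 \x m2)%E.-integrable setT (EFin \o (p \o (fun z : T1 * T2 => f z.1 z.2))).
Proof.
move=> pc mp; apply/integrable12ltyP; first exact/measurable_EFinP.
apply: le_lt_trans foo.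
have mc := measurable_ecabs mf.
apply: ge0_le_integral => //.
- by move=> x _; exact: integral_ge0.
- apply: (measurable_fun_fubini_tonelli_F (abse \o (EFin \o (p \o _)))).
    by apply: measurableT_comp => //; exact/measurable_EFinP.
  by move=> z; exact: abse_ge0.
- apply: (measurable_fun_fubini_tonelli_F (fun z => (cabs (f z.1 z.2))%:E)) => //.
  by move=> z; rewrite lee_fin cabs_ge0.
move=> x _; apply: ge0_le_integral => //.
- apply: measurableT_comp => //; apply/measurable_EFinP.
  exact: (measurableT_comp mp (measurable_pair1 x)).
- exact: measurableT_comp mc (measurable_pair1 x).
- by move=> y _ /=; rewrite lee_fin; exact: pc.
Qed.

Let iRe := integrable_part (@normr_Re R) mf.1.
Let iIm := integrable_part (@normr_Im R) mf.2.

Lemma cmeasurable_cintegral : cmeasurable (fun y => cintegral m1 (f ^~ y)).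
Proof.
by split; apply: measurableT_comp => //;
  [exact: (measurable_fubini_G iRe)|exact: (measurable_fubini_G iIm)].
Qed.

Lemma cintegral_prod : cintegral (m1 \x m2)%E (fun z => f z.1 z.2) =
  cintegral m1 (fun x => cintegral m2 (f x)).
Proof.
have iter (p : R[i] -> R) :
    (m1 \x m2)%E.-integrable setT (EFin \o (p \o (fun z : T1 * T2 => f z.1 z.2))) ->
    (forall x, m2.-integrable setT (EFin \o (p \o f x))) ->
    \int[(m1 \x m2)%E]_z p (f z.1 z.2) = \int[m1]_x \int[m2]_y p (f x y).
  move=> ip i1; congr fine.
  rewrite -(integral12_prod_meas1 ip).
  by apply: eq_integral => x _; rewrite fineK//; exact: integrable_fin_num (i1 x).
by apply: complex_ext => /=; apply: iter => // x; [exact: Lp1_Re|exact: Lp1_Im].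
Qed.

Lemma cfubini : cintegral m1 (fun x => cintegral m2 (f x)) =
  cintegral m2 (fun y => cintegral m1 (f ^~ y)).
Proof.
have swap (p : R[i] -> R) :
    (m1 \x m2)%E.-integrable setT (EFin \o (p \o (fun z : T1 * T2 => f z.1 z.2))) ->
    (forall x, m2.-integrable setT (EFin \o (p \o f x))) ->
    (forall y, m1.-integrable setT (EFin \o (p \o f ^~ y))) ->
    \int[m1]_x \int[m2]_y p (f x y) = \int[m2]_y \int[m1]_x p (f x y).
  move=> ip i1 i2; congr fine.
  have := Fubini ip; rewrite /= => H.
  rewrite (eq_integral (fun x => \int[m2]_y (p (f x y))%:E)%E); last first.
    by move=> x _; rewrite fineK//; exact: integrable_fin_num (i1 x).
  rewrite H; apply: eq_integral => y _.
  by rewrite fineK//; exact: integrable_fin_num (i2 y).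
by apply: complex_ext => /=; apply: swap => // *;
  [exact: Lp1_Re|exact: Lp1_Re|exact: Lp1_Im|exact: Lp1_Im].
Qed.

End complex_fubini.

(** * Sums over the lattice *)

Section counting_on_lattice.
Context (R : realType) (n : nat).
Local Notation cZ := (countZ R n).
Local Open Scope ereal_scope.

Lemma measurable_Zn d (T : measurableType d) (D : set (Zn n)) (f : Zn n -> T) :
  measurable_fun D f.
Proof. by []. Qed.

Lemma cmeasurable_Zn (f : Zn n -> R[i]) : cmeasurable f.
Proof. by split; exact: measurable_Zn. Qed.

(** A preimage is a countable union of products of a lattice point with a measurable set. *)
Lemma measurable_fun_Zn_prod d d' (T : measurableType d) (T' : measurableType d')
    (f : Zn n -> T -> T') :
  (forall k, measurable_fun setT (f k)) ->
  measurable_fun setT (fun z : Zn n * T => f z.1 z.2).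
Proof.
move=> mf _ B mB; rewrite setTI.
rewrite (_ : _ @^-1` B = \bigcup_k ([set k] `*` (f k @^-1` B))); last first.
  apply/seteqP; split => [[k w] /= Bk|[k w] [j _ [/= -> //]]].
  by exists k.
apply: countable_bigcupT_measurable => [|k]; first exact: countableP.
apply: measurableX => //.
by rewrite -(setTI (_ @^-1` _)); exact: mf.
Qed.

(** An exhaustion of the lattice by finite sets, given by an arbitrary enumeration. *)
Definition first_points (N : nat) : set (Zn n) := [set k | (choice.pickle k < N)%N].

Lemma bigcup_first_points : \bigcup_N first_points N = setT.
Proof. by apply/seteqP; split => // k _; exists (choice.pickle k).+1; rewrite /first_points /=. Qed.

Lemma finite_first_points N : finite_set (first_points N).
Proof.
apply: (@sub_finite_set _ _ ((fun i => odflt 0%R (choice.unpickle i)) @` `I_N)).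
  by move=> k /= kN; exists (choice.pickle k) => //; rewrite choice.pickleK.
exact/finite_image/finite_II.
Qed.

Lemma counting_finite (A : set (Zn n)) : finite_set A -> cZ A < +oo.
Proof. by move=> fA; rewrite /countZ /= /counting asboolT// ltry. Qed.

(** The counting measure under a name of its own, to which sigma-finiteness is attached:
    instances are indexed by the head constant, and that of [counting] already carries the
    instance for the natural numbers. *)
Definition lattice_counting (A : set (Zn n)) : \bar R := counting A.
HB.instance Definition _ := Measure.copy lattice_counting cZ.

Lemma sigma_finite_lattice_counting : sigma_finite setT lattice_counting.
Proof.
exists first_points; first by rewrite bigcup_first_points.
by move=> N; split => //; exact: counting_finite (finite_first_points N).
Qed.

HB.instance Definition _ :=
  @Measure_isSigmaFinite.Build _ _ _ lattice_counting sigma_finite_lattice_counting.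

Lemma counting_set1 (k : Zn n) : cZ [set k] = 1.
Proof.
by rewrite /countZ /= /counting asboolT//= fset_set1 cardfs1.
Qed.

Lemma integral_le_first_points (u : Zn n -> \bar R) (b : \bar R) : (forall k, 0 <= u k) ->
  (forall N, \int[cZ]_(k in first_points N) u k <= b) -> \int[cZ]_k u k <= b.
Proof.
move=> u0 ub; rewrite -bigcup_first_points.
have := @ge0_nondecreasing_set_cvg_integral _ _ _ first_points u cZ.
move=> /(_ _ _ _ _)/cvg_lim <-//; last first.
  by apply/nondecreasing_seqP => N; apply/subsetPset => k /= /ltnW.
apply: lime_le; last by near=> N.
apply: ereal_nondecreasing_is_cvgn.
apply: ge0_nondecreasing_set_nondecreasing_integral => //.
by apply/nondecreasing_seqP => N; apply/subsetPset => k /= /ltnW.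
Unshelve. all: by end_near. Qed.

Lemma term_le_integral (u : Zn n -> \bar R) (j : Zn n) : (forall k, 0 <= u k) ->
  u j <= \int[cZ]_k u k.
Proof.
move=> u0; apply: (@le_trans _ _ (\int[cZ]_(k in [set j]) u k)); last first.
  exact: ge0_subset_integral.
rewrite (eq_integral (cst (u j))); last by move=> k; rewrite inE => ->.
by rewrite integral_cst//= counting_set1 mule1.
Qed.

Lemma counting_bij (h h' : Zn n -> Zn n) (A : set (Zn n)) :
  cancel h h' -> cancel h' h -> counting (h @^-1` A) = counting A :> \bar R.
Proof.
move=> hK h'K.
have E : h @^-1` A = h' @` A.
  apply/seteqP; split => [k /= Ak|k [j Aj <-] /=]; last by rewrite h'K.
  by exists (h k).
have fE : finite_set (h @^-1` A) <-> finite_set A.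
  split=> [fA|fA]; last by rewrite E; exact: finite_image.
  rewrite (_ : A = h @` (h @^-1` A)); first exact: finite_image.
  apply/seteqP; split => [k Ak|k [j Aj <-] //].
  by exists (h' k); rewrite /= h'K.
rewrite /counting; case: ifPn => /asboolP fA; case: ifPn => /asboolP fB //.
- rewrite E fset_set_image// card_imfset//=; exact: can_inj h'K.
- by case: fB; apply/fE.
- by case: fA; apply/fE.
Qed.

Lemma reindex_integral (h h' : Zn n -> Zn n) (u : Zn n -> \bar R) :
  cancel h h' -> cancel h' h -> (forall k, 0 <= u k) ->
  \int[cZ]_k u (h k) = \int[cZ]_k u k.
Proof.
move=> hK h'K u0.
have E : pushforward cZ h = cZ :> (set (Zn n) -> \bar R).
  by apply/funext => A; exact: counting_bij hK h'K.
have mh : measurable_fun setT h by [].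
have := @ge0_integral_pushforward _ _ _ _ R h mh cZ setT u measurableT.
rewrite E preimage_setT => -> //.
Qed.

Lemma integral_shift (u : Zn n -> \bar R) (m : Zn n) : (forall k, 0 <= u k) ->
  \int[cZ]_k u (k - m)%R = \int[cZ]_k u k.
Proof.
by apply: (@reindex_integral (fun k => k - m)%R (fun k => k + m)%R) => k;
  rewrite ?addrK ?subrK.
Qed.

(** The substitution [m |-> k - m] is an involution. *)
Lemma integral_reflect (u : Zn n -> \bar R) (k : Zn n) : (forall k, 0 <= u k) ->
  \int[cZ]_m u (k - m)%R = \int[cZ]_m u m.
Proof.
by apply: (@reindex_integral (fun m => k - m)%R (fun m => k - m)%R) => m;
  rewrite opprB addrCA subrr addr0.
Qed.

End counting_on_lattice.

Section lattice_tonelli.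
Context (R : realType) (n : nat) d (T : measurableType d).
Variable mu : {sigma_finite_measure set T -> \bar R}.
Local Notation cZ := (countZ R n).
Local Open Scope ereal_scope.

Lemma tonelli_Zn (u : Zn n -> T -> \bar R) :
  (forall k, measurable_fun setT (u k)) -> (forall k y, 0 <= u k y) ->
  \int[cZ]_k \int[mu]_y u k y = \int[mu]_y \int[cZ]_k u k y.
Proof.
move=> mu_ u0.
exact (@fubini_tonelli _ _ _ _ _ (@lattice_counting R n) mu (fun z => u z.1 z.2)
  (measurable_fun_Zn_prod mu_) (fun z => u0 z.1 z.2)).
Qed.

Lemma integral_prod_Zn (u : Zn n * T -> \bar R) :
  measurable_fun setT u -> (forall z, 0 <= u z) ->
  \int[(cZ \x mu)]_z u z = \int[cZ]_k \int[mu]_y u (k, y).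
Proof.
move=> mu_ u0.
exact: (@fubini_tonelli1 _ _ _ _ _ (@lattice_counting R n) mu u).
Qed.

Lemma cfubini_Zn (f : Zn n -> T -> R[i]) :
  (forall k, Lp mu 1 (f k)) -> (forall y, Lp cZ 1 (f ^~ y)) ->
  \int[cZ]_k \int[mu]_y (cabs (f k y))%:E < +oo ->
  cmeasurable (fun y => cintegral cZ (f ^~ y)) /\
  cintegral cZ (fun k => cintegral mu (f k)) =
  cintegral mu (fun y => cintegral cZ (f ^~ y)).
Proof.
move=> f1 f2 foo.
have mf : cmeasurable (fun z : Zn n * T => f z.1 z.2).
  split; [apply: (measurable_fun_Zn_prod (f := fun k => @complex.Re R \o f k))|
    apply: (measurable_fun_Zn_prod (f := fun k => @complex.Im R \o f k))];
    by move=> k; case: (f1 k) => -[].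
split; first exact: (@cmeasurable_cintegral _ _ _ _ _ (@lattice_counting R n) mu f).
exact: (@cfubini _ _ _ _ _ (@lattice_counting R n) mu f).
Qed.

End lattice_tonelli.

(** * Expansions in an orthonormal system of unimodular functions *)

Section lattice_sums.
Context (R : realType) (n : nat).
Local Notation cZ := (countZ R n).

Lemma integral_supp1 (u : Zn n -> \bar R) (j : Zn n) :
  (forall k, k != j -> u k = 0%E) -> (\int[cZ]_k u k = u j)%E.
Proof.
move=> u0; transitivity (\int[cZ]_(k in [set j]) u k)%E.
  rewrite [RHS]integral_mkcond; apply: eq_integral => k _.
  rewrite patchE; case: ifPn => // kj; apply: u0.
  by apply: contra kj => /eqP ->; rewrite inE.
rewrite (eq_integral (cst (u j))); last by move=> k; rewrite inE => ->.
by rewrite integral_cst//= counting_set1 mule1.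
Qed.

Lemma csum_supp1 (f : Zn n -> R[i]) (j : Zn n) :
  (forall k, k != j -> f k = 0) -> csum f = f j.
Proof.
move=> f0; apply: complex_ext; rewrite /= /Rintegral (integral_supp1 (j := j))//;
  by move=> k kj; rewrite f0.
Qed.

(** Every term is at most the sum of all terms. *)
Lemma norm2_le_norm1 (c : Zn n -> R[i]) :
  (\int[cZ]_k (cabs (c k) ^+ 2)%:E <= (\int[cZ]_k (cabs (c k))%:E) ^+ 2)%E.
Proof.
have c0 k : (0 <= (cabs (c k))%:E)%E by rewrite lee_fin cabs_ge0.
have I0 : (0 <= \int[cZ]_k (cabs (c k))%:E)%E by exact: integral_ge0.
rewrite [leRHS]expe2 -ge0_integralZl//; apply: ge0_le_integral => //.
  by move=> x _; rewrite lee_fin sqr_ge0.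
by move=> k _; rewrite expr2 EFinM lee_wpmul2r//; exact: term_le_integral.
Qed.

Lemma norm2_fin_num (c : Zn n -> R[i]) : Lp cZ 1%E c ->
  (\int[cZ]_k (cabs (c k) ^+ 2)%:E)%E \is a fin_num.
Proof.
move=> [_]; rewrite LpNorm1E => cfin.
rewrite ge0_fin_numE; last by apply: integral_ge0 => k _; rewrite lee_fin sqr_ge0.
apply: (le_lt_trans (norm2_le_norm1 c)); apply: expe2_lty => //.
by apply: integral_ge0 => k _; rewrite lee_fin cabs_ge0.
Qed.

End lattice_sums.

Section orthonormal_system.
Context (R : realType) (n : nat) d (T : measurableType d).
Variable mu : probability T R.
Variable u : Zn n -> T -> R[i].
Local Notation cZ := (countZ R n).
Hypothesis mes_u : forall k, cmeasurable (u k).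
Hypothesis norm_u : forall k x, cabs (u k x) = 1.
Hypothesis orth_u : forall j k, cintegral mu (fun x => u j x * (u k x)^*) = (j == k)%:R.
Implicit Types (c : Zn n -> R[i]) (G : T -> R[i]).

Definition synth c (x : T) : R[i] := csum (fun k => c k * u k x).

Let Lp1_cst (a : R[i]) : Lp mu 1%E (fun=> a).
Proof.
split; first exact: cmeasurable_cst.
by rewrite LpNorm1E integral_cst//= probability_setT mule1 ltry.
Qed.

Let Lp1_bounded (v : T -> R[i]) (b : R) : cmeasurable v ->
  (forall x, cabs (v x) <= b) -> Lp mu 1%E v.
Proof.
move=> mv vb; have := Lp1_boundedM mv vb (Lp1_cst 1).
by under eq_fun do rewrite mulr1.
Qed.

Let synth_summable c x : Lp cZ 1%E c -> Lp cZ 1%E (fun k => c k * u k x).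
Proof.
rewrite /Lp !LpNorm1E => -[_ cfin]; split; first exact: cmeasurable_Zn.
by under eq_integral do rewrite cabsM norm_u mulr1.
Qed.

(** Fubini's theorem: the double sum-integral of [|c_k| |G(x)|] factors, so it is finite,
    and the slices are integrable at every point because the [u k] are unimodular. *)
Let synth_swap c G : Lp cZ 1%E c -> Lp mu 1%E G ->
  cmeasurable (fun x => csum (fun k => c k * (u k x * G x))) /\
  csum (fun k => c k * cintegral mu (fun x => u k x * G x)) =
  cintegral mu (fun x => synth c x * G x).
Proof.
move=> Lc LG.
have LuG k : Lp mu 1%E (fun x => u k x * G x).
  by apply: (@Lp1_boundedM _ _ _ _ _ _ 1) => // x; rewrite norm_u.
have Lf x : Lp cZ 1%E (fun k => c k * (u k x * G x)).
  under eq_fun do rewrite mulrA mulrC.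
  by apply: Lp1Z; exact: synth_summable.
have [|m E] := @cfubini_Zn R n _ _ mu (fun k x => c k * (u k x * G x))
   (fun k => Lp1Z (c k) (LuG k)) Lf.
  case: Lc LG => _ + [mG]; rewrite !LpNorm1E => cfin Gfin.
  under eq_integral => k _.
    under eq_integral do rewrite !cabsM norm_u mul1r EFinM.
    rewrite ge0_integralZl ?lee_fin ?cabs_ge0//; last 2 first.
    - exact: measurable_ecabs.
    - by move=> x _; rewrite lee_fin cabs_ge0.
    over.
  have G0 : (0 <= \int[mu]_x (cabs (G x))%:E)%E.
    by apply: integral_ge0 => x _; rewrite lee_fin cabs_ge0.
  rewrite ge0_integralZr//.
  - by rewrite lte_mul_pinfty ?ge0_fin_numE// integral_ge0// => k _; rewrite lee_fin cabs_ge0.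
  - by move=> k _; rewrite lee_fin cabs_ge0.
split=> //; rewrite -[LHS]/(csum _).
transitivity (csum (fun k => cintegral mu (fun x => c k * (u k x * G x)))).
  by apply: eq_cintegral => k; rewrite cintegralZ.
rewrite [LHS]E; apply: eq_cintegral => x.
rewrite mulrC -cintegralZ; last exact: synth_summable.
by apply: eq_cintegral => k; ring.
Qed.

Lemma cmeasurable_synth c : Lp cZ 1%E c -> cmeasurable (synth c).
Proof.
move=> Lc; have [+ _] := synth_swap Lc (Lp1_cst 1).
by under eq_fun do under [X in csum X]eq_fun do rewrite mulr1.
Qed.

Lemma cabs_synth_le c x : Lp cZ 1%E c ->
  ((cabs (synth c x))%:E <= \int[cZ]_k (cabs (c k))%:E)%E.
Proof.
move=> Lc; apply: (le_trans (cabs_cintegral (synth_summable x Lc))).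
by under eq_integral do rewrite cabsM norm_u mulr1.
Qed.

Lemma synth_bounded c : Lp cZ 1%E c -> exists b : R, forall x, cabs (synth c x) <= b.
Proof.
move=> Lc; have [_] := Lc; rewrite LpNorm1E => cfin.
exists (fine (\int[cZ]_k (cabs (c k))%:E)%E) => x.
rewrite -lee_fin fineK; first exact: cabs_synth_le.
by rewrite ge0_fin_numE// integral_ge0// => k _; rewrite lee_fin cabs_ge0.
Qed.

Let Lp1_synth_conj c j : Lp cZ 1%E c -> Lp mu 1%E (fun x => synth c x * (u j x)^*).
Proof.
move=> Lc; have [b cb] := synth_bounded Lc.
apply: (Lp1_boundedM (b := b)) => //; first exact: cmeasurable_synth.
apply: (@Lp1_bounded _ 1); first exact: cmeasurable_conj.
by move=> x; rewrite cabs_conj norm_u.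
Qed.

(** Term by term integration leaves a single diagonal term. *)
Lemma synth_coef c j : Lp cZ 1%E c ->
  cintegral mu (fun x => synth c x * (u j x)^*) = c j.
Proof.
move=> Lc.
have LG : Lp mu 1%E (fun x => (u j x)^*).
  apply: (@Lp1_bounded _ 1); first exact: cmeasurable_conj.
  by move=> x; rewrite cabs_conj norm_u.
have [_ <-] := synth_swap Lc LG.
rewrite (csum_supp1 (j := j)) ?orth_u ?eqxx ?mulr1// => k kj.
by rewrite orth_u (negbTE kj) mulr0.
Qed.

Lemma coef_le_norm1 c j : Lp cZ 1%E c ->
  ((cabs (c j))%:E <= \int[mu]_x (cabs (synth c x))%:E)%E.
Proof.
move=> Lc; rewrite -{1}(synth_coef j Lc).
apply: (le_trans (cabs_cintegral (Lp1_synth_conj j Lc))).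
by under eq_integral do rewrite cabsM cabs_conj norm_u mulr1.
Qed.

(** The sum is integrated term by term against its own conjugate. *)
Lemma parseval c : Lp cZ 1%E c ->
  (\int[mu]_x (cabs (synth c x) ^+ 2)%:E = \int[cZ]_k (cabs (c k) ^+ 2)%:E)%E.
Proof.
move=> Lc; have [b cb] := synth_bounded Lc; have ms := cmeasurable_synth Lc.
have Ls : Lp mu 1%E (fun x => (synth c x)^*).
  apply: (@Lp1_bounded _ b); first exact: cmeasurable_conj.
  by move=> x; rewrite cabs_conj.
have [_] := synth_swap Lc Ls.
under eq_fun => k.
  rewrite (_ : cintegral _ _ = (c k)^*); last first.
    rewrite -(synth_coef k Lc) -cintegral_conj; last exact: Lp1_synth_conj.
    by apply: eq_cintegral => x; rewrite rmorphM mulrC /= conjCK.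
  rewrite mulr_conj; over.
under [X in _ = cintegral _ X]eq_fun do rewrite mulr_conj.
move=> /(congr1 (@complex.Re R))/=; rewrite /Rintegral => E.
have fm : (\int[mu]_x (cabs (synth c x) ^+ 2)%:E)%E \is a fin_num.
  rewrite ge0_fin_numE; last by apply: integral_ge0 => x _; rewrite lee_fin sqr_ge0.
  apply: (@le_lt_trans _ _ (\int[mu]_x (b ^+ 2)%:E)%E).
    apply: ge0_le_integral => //.
    - by move=> x _; rewrite lee_fin sqr_ge0.
    - exact: measurable_ecabs2.
    - by move=> x _; rewrite lee_fin ler_pXn2r ?nnegrE ?cabs_ge0// (le_trans (cabs_ge0 _) (cb x)).
  by rewrite integral_cst//= probability_setT mule1 ltry.
have fc := norm2_fin_num Lc.
by rewrite -(fineK fm) -(fineK fc) E.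
Qed.

(** Let [c] agree with the coefficients of [G] on a finite set and vanish elsewhere, and let
    [S] be the sum of the [|c_k|^2]. Pairing [synth c] with [G] gives [S], so Cauchy-Schwarz
    and Parseval give [S^2 <= S ||G||^2]. Truncation makes [c] summable and [S] finite, so
    that [S] can be cancelled. *)
Lemma bessel G : Lp mu 1%E G ->
  (\int[cZ]_k (cabs (cintegral mu (fun x => G x * (u k x)^*)) ^+ 2)%:E <=
   \int[mu]_x (cabs (G x) ^+ 2)%:E)%E.
Proof.
move=> LG; set b := fun k => cintegral mu (fun x => G x * (u k x)^*).
have [mG] := LG; rewrite LpNorm1E => Gfin.
apply: integral_le_first_points => [k|N]; first by rewrite lee_fin sqr_ge0.
pose c k := if k \in first_points N then b k else 0.
have LGu k : Lp mu 1%E (fun x => G x * (u k x)^*).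
  under eq_fun do rewrite mulrC.
  apply: (@Lp1_boundedM _ _ _ _ _ _ 1) => //; first exact: cmeasurable_conj.
  by move=> x; rewrite cabs_conj norm_u.
have G0 : (0 <= \int[mu]_x (cabs (G x))%:E)%E.
  by apply: integral_ge0 => x _; rewrite lee_fin cabs_ge0.
have bB k : ((cabs (b k))%:E <= \int[mu]_x (cabs (G x))%:E)%E.
  apply: (le_trans (cabs_cintegral (LGu k))).
  by under eq_integral do rewrite cabsM cabs_conj norm_u mulr1.
have first_fin := counting_finite R (finite_first_points n N).
have cE (p : R -> R) : p 0 = 0 ->
    (\int[cZ]_k (p (cabs (c k)))%:E = \int[cZ]_(k in first_points N) (p (cabs (b k)))%:E)%E.
  move=> p0; rewrite [RHS]integral_mkcond; apply: eq_integral => k _.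
  by rewrite patchE /c; case: ifPn => // _; rewrite cabs0 p0.
have Lc : Lp cZ 1%E c.
  split; first exact: cmeasurable_Zn.
  rewrite LpNorm1E (cE id)//.
  apply: (@le_lt_trans _ _ (\int[cZ]_(k in first_points N) cst (\int[mu]_x (cabs (G x))%:E) k)%E).
    by apply: ge0_le_integral => //= k _; first [by rewrite lee_fin cabs_ge0|exact: bB].
  by rewrite integral_cst// lte_mul_pinfty// ge0_fin_numE.
rewrite -(cE (fun r => r ^+ 2)) ?expr0n//.
set S := (\int[cZ]_k _)%E.
have S0 : (0 <= S)%E by apply: integral_ge0 => k _; rewrite lee_fin sqr_ge0.
have PS := parseval Lc; have ms := cmeasurable_synth Lc; have [B sB] := synth_bounded Lc.
have Sfin : S \is a fin_num := norm2_fin_num Lc.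
have LGc : Lp mu 1%E (fun x => (G x)^*).
  split; first exact: cmeasurable_conj.
  by rewrite LpNorm1E; under eq_integral do rewrite cabs_conj.
have LsG : Lp mu 1%E (fun x => synth c x * (G x)^*) by apply: Lp1_boundedM LGc.
have SE : fine S = complex.Re (cintegral mu (fun x => synth c x * (G x)^*)).
  have [_ <-] := synth_swap Lc LGc.
  rewrite /S /=; congr fine; apply: eq_integral => k _; congr EFin.
  rewrite (_ : cintegral _ _ = (b k)^*); last first.
    rewrite -cintegral_conj//; apply: eq_cintegral => x.
    by rewrite rmorphM mulrC /= conjCK.
  rewrite /c; case: ifPn => _; first by rewrite mulr_conj.
  by rewrite mul0r cabs0 expr0n.
have Sle : (S <= \int[mu]_x (`|cabs (synth c x)| * `|cabs (G x)|)%:E)%E.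
  apply: (@le_trans _ _ (cabs (cintegral mu (fun x => synth c x * (G x)^*)))%:E).
    rewrite -(fineK Sfin) lee_fin SE.
    exact: le_trans (ler_norm _) (normr_Re _).
  apply: (le_trans (cabs_cintegral LsG)).
  by under eq_integral do rewrite cabsM cabs_conj -(ger0_norm (cabs_ge0 (synth _ _)))
     -(ger0_norm (cabs_ge0 (G _))).
have := cauchy_schwarz mu (measurable_cabs ms) (measurable_cabs mG).
rewrite PS -/S => CS.
have {}CS := le_trans (lee_expe2 S0 Sle) CS.
have [S0'|Sp] := eqVneq S 0%E.
  by rewrite S0'; apply: integral_ge0 => x _; rewrite lee_fin sqr_ge0.
rewrite expe2 lee_pmul2l// in CS.
by rewrite lt0e Sp.
Qed.

End orthonormal_system.

(** * Characters of the torus *)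

Lemma cintegral1 d (T : measurableType d) (R : realType) (mu : probability T R) :
  cintegral mu (fun=> 1 : R[i]) = 1.
Proof.
apply: complex_ext => /=; rewrite Rintegral_cst// ?mul0r// mul1r.
by rewrite [X in fine X]probability_setT.
Qed.

Section unit_circle.
Context (R : realType).

Definition cis (x : R) : R[i] := (cos (2 * pi * x) +i* sin (2 * pi * x))%C.

Lemma cisD (x y : R) : cis (x + y) = cis x * cis y.
Proof.
apply: complex_ext; rewrite ?ReM ?ImM /= mulrDr ?cosD ?sinD//.
by rewrite addrC.
Qed.

Lemma cis0 : cis 0 = 1.
Proof. by apply: complex_ext; rewrite /= mulr0 ?cos0 ?sin0. Qed.

Lemma cisN (x : R) : cis (- x) = (cis x)^*.
Proof. by apply: complex_ext; rewrite /= mulrN ?cosN ?sinN. Qed.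

Lemma cabs_cis (x : R) : cabs (cis x) = 1.
Proof. by rewrite cabsE /= cos2Dsin2 sqrtr1. Qed.

Lemma cis_int (a : int) : cis (a%:~R) = 1.
Proof.
have cisn (m : nat) : cis (m%:R) = 1.
  elim: m => [|m IH]; first exact: cis0.
  rewrite -addn1 natrD cisD IH mul1r; apply: complex_ext => /=.
    by rewrite mulr1 mulrC mulr_natr cos2pi.
  by rewrite mulr1 mulrC mulr_natr sin2pi.
case: a => m; first exact: cisn.
by rewrite NegzE mulrNz cisN -pmulrn cisn conjC1.
Qed.

Lemma cmeasurable_cis d (T : measurableType d) (f : T -> R) :
  measurable_fun setT f -> cmeasurable (fun x => cis (f x)).
Proof.
move=> mf; have m2 : measurable_fun setT (fun x => 2 * pi * f x).
  by apply: measurable_funM => //; exact: measurable_cst.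
split.
- apply: (@measurableT_comp _ _ _ _ _ _ (@cos R)) m2 => //.
  by apply: continuous_measurable_fun; exact: continuous_cos.
- apply: (@measurableT_comp _ _ _ _ _ _ (@sin R)) m2 => //.
  by apply: continuous_measurable_fun; exact: continuous_sin.
Qed.

Local Notation U := (uniform_prob (@ltr01 R)).

(** Adding 1 makes the integrand nonnegative, as [integral_uniform] requires; hence [F] is a
    primitive of [1 + p]. *)
Let uniform_FTC (p F : R -> R) :
  continuous p -> (forall x, -1 <= p x <= 1) ->
  (forall x : R, is_derive x (1 : R) F (1 + p x)) -> F 1 - F 0 = 1 ->
  \int[U]_x p x = 0.
Proof.
move=> cp p1 dF F1.
have mp : measurable_fun setT p by exact: continuous_measurable_fun.
have ip : U.-integrable setT (EFin \o p).
  apply/integrableP; split; first exact/measurable_EFinP.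
  apply: (@le_lt_trans _ _ (\int[U]_x (cst 1%E) x)%E).
    apply: ge0_le_integral => //.
      by apply: measurableT_comp => //; exact/measurable_EFinP.
    by move=> x _ /=; rewrite lee_fin ler_norml.
  by rewrite integral_cst//= probability_setT mule1 ltry.
have i1 : U.-integrable setT (EFin \o (fun=> 1 : R)).
  exact: finite_measure_integrable_cst.
have E : (\int[U]_x (1 + p x)%:E = 1)%E.
  rewrite integral_uniform; last 2 first.
  - by apply/measurable_EFinP; apply: measurable_funD => //; exact: measurable_cst.
  - by move=> x; rewrite lee_fin; have /andP[] := p1 x; lra.
  rewrite subr0 invr1 mul1e (@continuous_FTC2 _ _ F)//.
  - by rewrite -EFinB F1.
  - apply: continuous_subspaceT => x; apply: cvgD; [exact: cvg_cst|exact: cp].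
  - have cF x : {for x, continuous F}.
      by apply: differentiable_continuous; apply/derivable1_diffP; exact: (@ex_derive _ _ _ _ _ _ _ (dF x)).
    split.
    + by move=> x _; exact: (@ex_derive _ _ _ _ _ _ _ (dF x)).
    + by apply: cvg_at_right_filter; exact: cF.
    + by apply: cvg_at_left_filter; exact: cF.
  - by move=> x _; rewrite derive1E derive_val.
have := RintegralD measurableT i1 ip.
have I1 : \int[U]_x (1 : R) = 1.
  by rewrite Rintegral_cst// mul1r [X in fine X]probability_setT.
rewrite [X in X = _]/Rintegral E I1.
by move=> /eqP; rewrite /= addrC -subr_eq subrr eq_sym => /eqP.
Qed.

Lemma cintegral_cis (a : int) :
  cintegral U (fun x => cis (x * a%:~R)) = (a == 0)%:R.
Proof.
have [->|a0] := eqVneq a 0.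
  rewrite (@eq_cintegral _ _ _ _ _ (fun=> 1)); last by move=> x; rewrite mulr0 cis0.
  exact: cintegral1.
pose al : R := 2 * pi * a%:~R.
have al0 : al != 0.
  by rewrite !mulf_neq0 ?intr_eq0 ?pnatr_eq0// gt_eqF// pi_gt0.
have alE x : 2 * pi * (x * a%:~R) = al * x by rewrite /al; ring.
have dal x : is_derive x (1 : R) ( *%R al) al.
  by have := @is_deriveZ _ _ _ id al x 1 1 _; rewrite /GRing.scale /= mulr1; apply; exact: is_derive_id.
have [c1 s1] : cos al = 1 /\ sin al = 0.
  by have := cis_int a => -[]; rewrite /cis -/al.
apply: complex_ext => /=.
- under eq_Rintegral do rewrite alE.
  apply: (@uniform_FTC _ (fun x => x + al^-1 * sin (al * x))).
  + move=> x; apply: continuous_comp; last exact: continuous_cos.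
    exact: mulrl_continuous.
  + by move=> x; rewrite cos_geN1 cos_le1.
  + move=> x.
    have dc := @is_derive1_comp _ (@sin R) ( *%R al) x _ _ (is_derive_sin _) (dal x).
    have dz := @is_deriveZ _ _ _ _ al^-1 x 1 _ dc.
    have := @is_deriveD _ _ _ id _ x 1 _ _ (is_derive_id _ _) dz.
    by rewrite /GRing.scale /= mulrCA mulVf// mulr1.
  + by rewrite mulr1 mulr0 s1 sin0; lra.
- under eq_Rintegral do rewrite alE.
  apply: (@uniform_FTC _ (fun x => x - al^-1 * cos (al * x))).
  + move=> x; apply: continuous_comp; last exact: continuous_sin.
    exact: mulrl_continuous.
  + by move=> x; rewrite sin_geN1 sin_le1.
  + move=> x.
    have dc := @is_derive1_comp _ (@cos R) ( *%R al) x _ _ (is_derive_cos _) (dal x).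
    have dz := @is_deriveZ _ _ _ _ al^-1 x 1 _ dc.
    have := @is_deriveB _ _ _ id _ x 1 _ _ (is_derive_id _ _) dz.
    by rewrite /GRing.scale /= mulrCA mulVf// mulr1 opprK.
  + by rewrite mulr1 mulr0 c1 cos0; lra.
Qed.

End unit_circle.

Section torus_characters.
Context (R : realType).

Lemma measurable_dot n (k : Zn n) : measurable_fun setT (fun w : Tn R n => dot w k).
Proof.
apply: measurable_sum => i; apply: measurable_funM; last exact: measurable_cst.
exact: measurable_tnth.
Qed.

Lemma dotD n (w : Tn R n) (j k : Zn n) : dot w (j + k) = dot w j + dot w k.
Proof.
rewrite /dot -big_split /=; apply: eq_bigr => i _.
by rewrite mxE intrD mulrDr.
Qed.

Lemma dotN n (w : Tn R n) (k : Zn n) : dot w (- k) = - dot w k.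
Proof.
rewrite /dot -sumrN; apply: eq_bigr => i _.
by rewrite mxE mulrNz mulrN.
Qed.

Lemma dot_cons n (x : R) (w : Tn R n) (k : Zn n.+1) :
  dot (torus_cons (x, w)) k =
  x * (k 0 0)%:~R + dot w (\row_i k 0 (lift ord0 i) : Zn n).
Proof.
rewrite /dot big_ord_recl; congr (_ + _); apply: eq_bigr => i _.
by rewrite mxE tnthS.
Qed.

Let cintegral_torus_cons n (f : Tn R n.+1 -> R[i]) :
  cmeasurable f -> (forall w, cabs (f w) = 1) ->
  cintegral (haar R n.+1) f =
  cintegral (uniform_prob (@ltr01 R)) (fun x =>
    cintegral (haar R n) (fun w => f (torus_cons (x, w)))).
Proof.
move=> mf f1.
pose g (x : measurableTypeR R) (w : Tn R n) := f (torus_cons (x, w)).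
have mg : cmeasurable (fun z : measurableTypeR R * Tn R n => g z.1 z.2).
  rewrite (_ : (fun z => _) = f \o @torus_cons R n); last by apply/funext => -[].
  have mc := @measurable_torus_cons R n.
  by split; [exact: (measurableT_comp mf.1 mc)|exact: (measurableT_comp mf.2 mc)].
have g1 x w : cabs (g x w) = 1 by exact: f1.
have gx x : Lp (haar R n) 1 (g x).
  split.
    split; [exact: (measurableT_comp mg.1 (measurable_pair1 x))|
            exact: (measurableT_comp mg.2 (measurable_pair1 x))].
  rewrite LpNorm1E; under eq_integral do rewrite g1.
  by rewrite integral_cst//= probability_setT mule1 ltry.
have goo : (\int[uniform_prob (@ltr01 R)]_x \int[haar R n]_w (cabs (g x w))%:E < +oo)%E.
  under eq_integral do under eq_integral do rewrite g1.
  under eq_integral do rewrite integral_cst//= probability_setT mule1.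
  by rewrite integral_cst//= probability_setT mule1 ltry.
rewrite -[RHS](cintegral_prod mg gx goo).
have Lg : Lp (uniform_prob (@ltr01 R) \x haar R n)%E 1 (fun z => g z.1 z.2).
  split => //; rewrite LpNorm1E; under eq_integral do rewrite g1.
  by rewrite integral_cst//= probability_setT mule1 ltry.
have gE : (fun z => g z.1 z.2) = f \o @torus_cons R n by apply/funext => -[].
rewrite gE in Lg *.
apply: complex_ext => /=; congr fine.
- rewrite [LHS](@integral_distribution _ _ _ _ _ _ (@torus_cons R n))//.
    by apply/measurable_EFinP; exact: mf.1.
  exact: Lp1_Re Lg.
- rewrite [LHS](@integral_distribution _ _ _ _ _ _ (@torus_cons R n))//.
    by apply/measurable_EFinP; exact: mf.2.
  exact: Lp1_Im Lg.
Qed.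

Lemma cmeasurable_char n (k : Zn n) : cmeasurable (fun w : Tn R n => cis (dot w k)).
Proof. by apply: cmeasurable_cis; exact: measurable_dot. Qed.

(** By induction on the dimension: a character is the product of a character of the first
    coordinate and one of the others, and each integral vanishes unless its frequency is 0. *)
Lemma cintegral_char n (k : Zn n) :
  cintegral (haar R n) (fun w => cis (dot w k)) = (k == 0)%:R.
Proof.
elim: n k => [|n IH] k.
  have -> : k = 0 by apply/rowP => -[].
  rewrite eqxx (@eq_cintegral _ _ _ _ _ (fun=> 1)); last first.
    by move=> w; rewrite /dot big_ord0 cis0.
  exact: cintegral1.
rewrite cintegral_torus_cons; [|exact: cmeasurable_char|by move=> w; rewrite cabs_cis].
set k' : Zn n := \row_i k 0 (lift ord0 i).
have LC : Lp (haar R n) 1 (fun w => cis (dot w k')).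
  split; first exact: cmeasurable_char.
  rewrite LpNorm1E; under eq_integral do rewrite cabs_cis.
  by rewrite integral_cst//= probability_setT mule1 ltry.
rewrite (@eq_cintegral _ _ _ _ _ (fun x : measurableTypeR R => (k' == 0)%:R * cis ((x : R) * (k 0 0)%:~R))); last first.
  move=> x; rewrite -IH mulrC -cintegralZ//.
  by apply: eq_cintegral => w; rewrite dot_cons cisD.
rewrite cintegralZ; last first.
  split; first by apply: cmeasurable_cis; apply: measurable_funM.
  rewrite LpNorm1E; under eq_integral do rewrite cabs_cis.
  by rewrite integral_cst//= probability_setT mule1 ltry.
rewrite cintegral_cis -natrM mulnb; congr (_%:R); congr nat_of_bool.
apply/andP/eqP => [[/eqP k'0 /eqP k00]|k0].
  apply/rowP => i; rewrite mxE; case: (unliftP ord0 i) => [j|] ->//.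
  by move/rowP: k'0 => /(_ j); rewrite !mxE.
by rewrite /k' k0; split; [apply/eqP/rowP => i|]; rewrite !mxE.
Qed.

Lemma char_orthonormal n (j k : Zn n) :
  cintegral (haar R n) (fun w => (cis (dot w j))^* * ((cis (dot w k))^*)^*) =
  (j == k)%:R.
Proof.
rewrite (@eq_cintegral _ _ _ _ _ (fun w => cis (dot w (k - j)))).
  by rewrite cintegral_char subr_eq0 eq_sym.
by move=> w; rewrite conjCK dotD dotN cisD cisN mulrC.
Qed.

End torus_characters.

(** * The short-time Fourier transform on square summable functions *)

Section square_summable.
Context (R : realType) (n : nat).
Local Notation cZ := (countZ R n).
Implicit Types f g h : Zn n -> R[i].

Lemma l2normE f : (l2norm f ^+ 2 = \int[cZ]_k (cabs (f k) ^+ 2)%:E)%E.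
Proof. exact: LpNorm2E. Qed.

Lemma l2norm_ge0 f : (0 <= l2norm f)%E.
Proof. exact: Lnorm_ge0. Qed.

Lemma l2P f : (\int[cZ]_k (cabs (f k) ^+ 2)%:E < +oo)%E -> l2 f.
Proof.
move=> fi; split; first exact: cmeasurable_Zn.
by apply: lty_expe2; [exact: l2norm_ge0|rewrite l2normE].
Qed.

Lemma l2norm_fin f : l2 f -> exists2 r : R, 0 <= r & l2norm f = r%:E.
Proof.
move=> [_ fi]; exists (fine (l2norm f)); first by rewrite fine_ge0// l2norm_ge0.
by rewrite fineK// ge0_fin_numE// l2norm_ge0.
Qed.

Lemma summable_l2 f : Lp cZ 1%E f -> l2 f.
Proof.
move=> [_]; rewrite LpNorm1E => fi; apply: l2P.
apply: (le_lt_trans (norm2_le_norm1 f)); apply: expe2_lty => //.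
by apply: integral_ge0 => k _; rewrite lee_fin cabs_ge0.
Qed.

Lemma l2_linear (a : R[i]) f h : l2 f -> l2 h -> l2 (fun k => a * f k + h k).
Proof.
move=> lf lh; apply: l2P.
have c0 (c : R) (u : Zn n -> R[i]) k : 0 <= c -> (0 <= (c * cabs (u k) ^+ 2)%:E)%E.
  by move=> ?; rewrite lee_fin mulr_ge0// sqr_ge0.
have cfin (c : R) (u : Zn n -> R[i]) : 0 <= c -> l2 u ->
    (\int[cZ]_k (c * cabs (u k) ^+ 2)%:E < +oo)%E.
  move=> ? lu; under eq_integral do rewrite EFinM.
  rewrite ge0_integralZl//; last by move=> k _; rewrite lee_fin sqr_ge0.
  by rewrite -l2normE; have [r _ ->] := l2norm_fin lu; rewrite expe2 -!EFinM ltry.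
apply: (@le_lt_trans _ _ (\int[cZ]_k ((2 * cabs a ^+ 2 * cabs (f k) ^+ 2)%:E +
    (2 * cabs (h k) ^+ 2)%:E))%E).
  apply: ge0_le_integral => //.
  - by move=> k _; rewrite lee_fin sqr_ge0.
  - move=> k _; rewrite -EFinD lee_fin -mulrA -exprMn -cabsM.
    exact: sqr_cabsD_le.
rewrite ge0_integralD//; last 2 first.
- by move=> k _; apply: c0; rewrite mulr_ge0// sqr_ge0.
- by move=> k _; exact: c0.
by rewrite lte_add_pinfty// cfin// mulr_ge0// sqr_ge0.
Qed.

(** Cauchy-Schwarz and translation invariance of the sum. *)
Lemma norm1_mul_shift f g (m : Zn n) :
  (\int[cZ]_k (cabs (f k) * cabs (g (k - m)%R))%:E <= l2norm f * l2norm g)%E.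
Proof.
apply: expe2_le.
- by apply: integral_ge0 => k _; rewrite lee_fin mulr_ge0 ?cabs_ge0.
- by rewrite mule_ge0 ?l2norm_ge0.
have := @cauchy_schwarz _ _ R cZ (fun k => cabs (f k)) (fun k => cabs (g (k - m)))
  (measurable_Zn _) (measurable_Zn _).
rewrite (@integral_shift R n (fun k => (cabs (g k) ^+ 2)%:E) m); last first.
  by move=> k; rewrite lee_fin sqr_ge0.
rewrite expe2M !l2normE; congr (_ ^+ 2 <= _)%E.
by apply: eq_integral => k _; rewrite !ger0_norm ?cabs_ge0.
Qed.

(** Summing over the shift [m] first decouples the two factors. *)
Lemma norm2_mul_shift f g :
  (\int[cZ]_m \int[cZ]_k ((cabs (f k) * cabs (g (k - m)%R)) ^+ 2)%:E =
   (l2norm f * l2norm g) ^+ 2)%E.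
Proof.
have g0 k : (0 <= (cabs (g k) ^+ 2)%:E)%E by rewrite lee_fin sqr_ge0.
rewrite [LHS](@tonelli_Zn R n _ _ (@lattice_counting R n)
  (fun m k => ((cabs (f k) * cabs (g (k - m)%R)) ^+ 2)%:E))//; last first.
  by move=> m k; rewrite lee_fin sqr_ge0.
rewrite expe2M !l2normE.
transitivity (\int[cZ]_k ((cabs (f k) ^+ 2)%:E * \int[cZ]_k (cabs (g k) ^+ 2)%:E))%E; last first.
  rewrite ge0_integralZr//; first by move=> k _; rewrite lee_fin sqr_ge0.
  exact: integral_ge0.
apply: eq_integral => k _.
rewrite -(@integral_reflect R n (fun k => (cabs (g k) ^+ 2)%:E) k)//.
rewrite -ge0_integralZl ?lee_fin ?sqr_ge0//.
by apply: eq_integral => m _; rewrite -EFinM exprMn.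
Qed.

End square_summable.

Section short_time_fourier.
Context (R : realType) (n : nat).
Local Notation cZ := (countZ R n).
Local Notation haarn := (haar R n).
Implicit Types f g h : Zn n -> R[i].

(** Time-frequency shifts of the window enter the transform conjugated, so its slices are
    expanded in the conjugate characters. *)
Definition conj_char (k : Zn n) (w : Tn R n) : R[i] := (cis (dot w k))^*.

Definition stft_coef g f (m k : Zn n) : R[i] := f k * (g (k - m))^*.

Let mes_u k : cmeasurable (conj_char k).
Proof. by apply: cmeasurable_conj; exact: cmeasurable_char. Qed.

Let norm_u k w : cabs (conj_char k w) = 1.
Proof. by rewrite cabs_conj cabs_cis. Qed.

Let orth_u j k : cintegral haarn (fun w => conj_char j w * (conj_char k w)^*) = (j == k)%:R.
Proof. exact: char_orthonormal. Qed.

Lemma stft_synth g f m w : stft g f (m, w) = synth conj_char (stft_coef g f m) w.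
Proof.
apply: eq_cintegral => k; rewrite /stft_coef /conj_char /modulate /translate /=.
by rewrite rmorphM mulrA mulrAC.
Qed.

Lemma cabs_stft_coef g f m k :
  cabs (stft_coef g f m k) = cabs (f k) * cabs (g (k - m)).
Proof. by rewrite cabsM cabs_conj. Qed.

Lemma summable_stft_coef g f m : l2 f -> l2 g -> Lp cZ 1%E (stft_coef g f m).
Proof.
move=> lf lg; split; first exact: cmeasurable_Zn.
rewrite LpNorm1E; under eq_integral do rewrite cabs_stft_coef.
apply: (le_lt_trans (norm1_mul_shift f g m)).
have [r r0 ->] := l2norm_fin lf; have [s s0 ->] := l2norm_fin lg.
by rewrite -EFinM ltry.
Qed.

Lemma stft_linear g f h (a : R[i]) mw : l2 f -> l2 h -> l2 g ->
  stft g (fun k => a * f k + h k) mw = a * stft g f mw + stft g h mw.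
Proof.
case: mw => m w lf lh lg; have Lf := summable_stft_coef m lf lg.
have Lh := summable_stft_coef m lh lg.
have Lu c : Lp cZ 1%E c -> Lp cZ 1%E (fun k => c k * conj_char k w).
  move=> Lc; under eq_fun do rewrite mulrC.
  by apply: (@Lp1_boundedM _ _ _ _ _ _ 1) Lc => [|k];
    [exact: cmeasurable_Zn|rewrite norm_u].
rewrite !stft_synth -[a * _]cintegralZ; last exact: Lu.
rewrite -[RHS]cintegralD; [|exact/Lp1Z/Lu|exact: Lu].
by apply: eq_cintegral => k; rewrite /stft_coef; ring.
Qed.

Lemma cmeasurable_stft g f m : l2 f -> l2 g -> cmeasurable (fun w => stft g f (m, w)).
Proof.
move=> lf lg; under eq_fun do rewrite stft_synth.
exact: (cmeasurable_synth haarn mes_u norm_u (summable_stft_coef m lf lg)).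
Qed.

Lemma cabs_stft_le g f m w : l2 f -> l2 g ->
  ((cabs (stft g f (m, w)))%:E <= l2norm f * l2norm g)%E.
Proof.
move=> lf lg; rewrite stft_synth.
apply: (@le_trans _ _ (\int[cZ]_k (cabs (stft_coef g f m k))%:E)%E).
  by apply: (cabs_synth_le norm_u); exact: summable_stft_coef.
by under eq_integral do rewrite cabs_stft_coef; exact: norm1_mul_shift.
Qed.

(** Moyal's identity, from Parseval's identity at each time shift. *)
Lemma moyal g f : l2 f -> l2 g ->
  (\int[cZ]_m \int[haarn]_w (cabs (stft g f (m, w)) ^+ 2)%:E =
   (l2norm f * l2norm g) ^+ 2)%E.
Proof.
move=> lf lg; rewrite -norm2_mul_shift; apply: eq_integral => m _.
under eq_integral do rewrite stft_synth.
rewrite (parseval mes_u norm_u orth_u) //; last exact: summable_stft_coef.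
by apply: eq_integral => k _; rewrite cabs_stft_coef.
Qed.

Lemma bessel_char G : Lp haarn 1%E G ->
  (\int[cZ]_k (cabs (cintegral haarn (fun w => G w * cis (dot w k))) ^+ 2)%:E <=
   \int[haarn]_w (cabs (G w) ^+ 2)%:E)%E.
Proof.
move=> LG; apply: le_trans (bessel mes_u norm_u orth_u LG).
by under [in leRHS]eq_integral do under eq_cintegral do rewrite conjCK.
Qed.

Lemma stft_coef_le g f m k : Lp cZ 1%E (stft_coef g f m) ->
  ((cabs (f k) * cabs (g (k - m)%R))%:E <= \int[haarn]_w (cabs (stft g f (m, w)))%:E)%E.
Proof.
move=> L; rewrite -cabs_stft_coef.
under [in leRHS]eq_integral do rewrite stft_synth.
exact: (coef_le_norm1 mes_u norm_u orth_u).
Qed.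

End short_time_fourier.

(** * The modulation space M^1 *)

Section modulation_space.
Context (R : realType) (n : nat).
Local Notation cZ := (countZ R n).
Local Notation haarn := (haar R n).
Implicit Types f g : Zn n -> R[i].

Lemma weight_ge1 (k : Zn n) : 1 <= weight R k.
Proof. by rewrite lerDl sqrtr_ge0. Qed.

(** The factor 2 leaves room for [|k|^2 <= 2 |m|^2 + 2 |k - m|^2] to replace the triangle
    inequality for the Euclidean norm. *)
Lemma weight_shift (m k : Zn n) : weight R k <= 2 * weight R m * weight R (k - m).
Proof.
rewrite /weight.
set K := \sum_(i < n) (k 0 i)%:~R ^+ 2.
set A := \sum_(i < n) (m 0 i)%:~R ^+ 2.
set B := \sum_(i < n) ((k - m) 0 i)%:~R ^+ 2.
have A0 : 0 <= A by apply: sumr_ge0 => i _; rewrite sqr_ge0.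
have B0 : 0 <= B by apply: sumr_ge0 => i _; rewrite sqr_ge0.
have KAB : K <= 2 * A + 2 * B.
  rewrite /K /A /B !mulr_sumr -big_split; apply: ler_sum => i _ /=.
  rewrite !mxE intrD mulrNz.
  set x := (k 0 i)%:~R; set y := (m 0 i)%:~R.
  have := sqr_ge0 (x - 2 * y : R); rewrite !expr2; nra.
have a0 := sqrtr_ge0 A; have b0 := sqrtr_ge0 B.
have : Num.sqrt K <= 2 * Num.sqrt A + 2 * Num.sqrt B.
  rewrite -[leRHS]ger0_norm; last lra.
  rewrite -sqrtr_sqr ler_wsqrtr//; apply: (le_trans KAB).
  have := sqr_sqrtr A0; have := sqr_sqrtr B0; rewrite !expr2.
  have := mulr_ge0 a0 b0; nra.
have := mulr_ge0 a0 b0; nra.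
Qed.

(** Conjugated translates of the window are test functions, so a tempered [f] makes the
    series defining its short-time Fourier transform absolutely convergent. *)
Lemma schwartz_conj_shift g (m : Zn n) :
  schwartz g -> schwartz (fun k => (g (k - m))^*).
Proof.
move=> sg N; have [M gM] := sg N.
have w0 (k : Zn n) : 0 <= weight R k by rewrite (le_trans _ (weight_ge1 k)).
exists ((2 * weight R m) ^+ N * M) => k; rewrite cabs_conj.
apply: (@le_trans _ _ ((2 * weight R m) ^+ N *
    (weight R (k - m) ^+ N * cabs (g (k - m))))); last first.
  by rewrite ler_wpM2l// exprn_ge0// mulr_ge0.
rewrite mulrA ler_wpM2r ?cabs_ge0// -exprMn lerXn2r ?nnegrE ?mulr_ge0//.
exact: weight_shift.
Qed.

Lemma modNorm1E g f : cmeasurable (stft g f) ->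
  (modNorm g 1 f = \int[cZ]_m \int[haarn]_w (cabs (stft g f (m, w)))%:E)%E.
Proof.
move=> ms; rewrite /modNorm LpNorm1E.
rewrite [LHS](@integral_prod_Zn R n _ _ haarn (fun z => (cabs (stft g f z))%:E))//.
- exact: measurable_ecabs.
- by move=> z; rewrite lee_fin cabs_ge0.
Qed.

Section window.
Variables (g f : Zn n -> R[i]).
Hypotheses (sg : schwartz g) (Mf : modSpace g 1%E f).

Let A (m : Zn n) : \bar R := (\int[haarn]_w (cabs (stft g f (m, w)))%:E)%E.

Let A0 m : (0 <= A m)%E.
Proof. by apply: integral_ge0 => w _; rewrite lee_fin cabs_ge0. Qed.

Let AE : (\int[cZ]_m A m = modNorm g 1 f)%E.
Proof. by rewrite modNorm1E//; case: Mf => _ []. Qed.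

Let Afin : (\int[cZ]_m A m < +oo)%E.
Proof. by rewrite AE; case: Mf => _ []. Qed.

(** Each product of values of [f] and [g] is a Fourier coefficient of a time slice of
    the transform. *)
Let mul_le_A m k : ((cabs (f k) * cabs (g (k - m)%R))%:E <= A m)%E.
Proof. by apply: stft_coef_le; apply: Mf.1.1; exact: schwartz_conj_shift. Qed.

Let summable_of_mul (u : Zn n -> R[i]) (r : R) : 0 < r ->
  (\int[cZ]_k (r * cabs (u k))%:E < +oo)%E -> Lp cZ 1%E u.
Proof.
move=> r0 ufin; split; first exact: cmeasurable_Zn.
rewrite LpNorm1E; have := ufin.
under [X in (X < _)%E -> _]eq_integral do rewrite EFinM.
have I0 : (0 <= \int[cZ]_k (cabs (u k))%:E)%E.
  by apply: integral_ge0 => k _; rewrite lee_fin cabs_ge0.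
rewrite ge0_integralZl//; last 2 first.
- by move=> k _; rewrite lee_fin cabs_ge0.
- by rewrite lee_fin ltW.
move: (\int[cZ]_k (cabs (u k))%:E)%E I0 => [x| |]// _; last by rewrite gt0_muley.
by move=> _; exact: ltry.
Qed.

(** With [m = k - j], where [g j <> 0], the second factor of [f k * g (k - m)] is constant;
    then sum over [k]. *)
Lemma modSpace1_summable : (exists k, g k <> 0) -> Lp cZ 1%E f.
Proof.
move=> [j gj]; apply: (summable_of_mul (cabs_gt0 gj)).
rewrite (le_lt_trans _ Afin)// -(@integral_shift R n A j)//.
apply: ge0_le_integral => //.
- by move=> k _; rewrite lee_fin mulr_ge0 ?cabs_ge0.
- by move=> k _; have := mul_le_A (k - j) k; rewrite opprB addrCA subrr addr0 mulrC.
Qed.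

(** With [m = j - k], where [f j <> 0], the first factor of [f j * g (j - m)] is constant. *)
Let window_summable : (exists k, f k <> 0) -> Lp cZ 1%E g.
Proof.
move=> [j fj]; apply: (summable_of_mul (cabs_gt0 fj)).
rewrite (le_lt_trans _ Afin)// -(@integral_reflect R n A j)//.
apply: ge0_le_integral => //.
- by move=> k _; rewrite lee_fin mulr_ge0 ?cabs_ge0.
- by move=> k _; have := mul_le_A (j - k) j; rewrite opprB addrCA subrr addr0.
Qed.

(** The sum over [m] and [k] of [|f k * g (k - m)|^2] is the square of the left-hand side [q].
    Bounding one factor of each square by [A m] and summing the other by Cauchy-Schwarz gives
    [q^2 <= q ||V_g f||_1]. *)
Lemma l2norm_window_le : (exists k, g k <> 0) ->
  (l2norm g * l2norm f <= modNorm g 1 f)%E.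
Proof.
move=> g0; have lf := summable_l2 (modSpace1_summable g0).
(* The window is known to be square summable only when [f] is not identically zero. *)
have [f0|/existsNP fn0] := pselect (forall k, f k = 0).
  rewrite (_ : l2norm f = 0)%E ?mule0; first exact: Lnorm_ge0.
  apply/eqP; rewrite eq_le l2norm_ge0 andbT; apply: expe2_le => //.
    exact: l2norm_ge0.
  rewrite l2normE integral0_eq; first by rewrite expe2 mule0.
  by move=> k _; rewrite f0 cabs0 expr0n.
have lg := summable_l2 (window_summable fn0).
have [r r0 rE] := l2norm_fin lf; have [s s0 sE] := l2norm_fin lg.
rewrite rE sE -EFinM mulrC; set q := r * s.
have q0 : 0 <= q by rewrite mulr_ge0.
have [->|qn0] := eqVneq q 0; first exact: Lnorm_ge0.
have qp : (0 < q%:E)%E by rewrite lte_fin lt_neqAle eq_sym qn0.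
rewrite -(@lee_pmul2l _ q%:E)// -AE -ge0_integralZl//.
rewrite -expe2 [in leLHS]/q EFinM -rE -sE -norm2_mul_shift.
apply: ge0_le_integral => //.
- by move=> m _; apply: integral_ge0 => k _; rewrite lee_fin sqr_ge0.
move=> m _; apply: (@le_trans _ _
    (\int[cZ]_k (A m * (cabs (f k) * cabs (g (k - m)%R))%:E))%E).
  apply: ge0_le_integral => //.
  - by move=> k _; rewrite lee_fin sqr_ge0.
  - move=> k _; rewrite expr2 EFinM; apply: lee_wpmul2r => //.
    by rewrite lee_fin mulr_ge0 ?cabs_ge0.
rewrite ge0_integralZl//; last first.
  by move=> k _; rewrite lee_fin mulr_ge0 ?cabs_ge0.
rewrite muleC; apply: lee_wpmul2r => //.
exact: norm1_mul_shift.
Qed.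

End window.

End modulation_space.

(** * Localization operators *)

Section bounded_symbol.
Context (R : realType) (n : nat).
Local Notation haarn := (haar R n).
Variable sigma : Zn n * Tn R n -> R[i].
Hypothesis Lsigma : Lp (phase_measure R n) +oo%E sigma.

Lemma phase_measure_gt0 : (0 < phase_measure R n setT)%E.
Proof.
rewrite (_ : phase_measure R n setT = countZ R n setT * haarn setT)%E; last first.
  by rewrite -setXTT; exact: product_measure1E.
rewrite [X in (_ * X)%E]probability_setT mule1.
apply: (@lt_le_trans _ _ (countZ R n [set 0])).
  by rewrite counting_set1.
by apply: le_measure; rewrite ?inE.
Qed.

(** A null set of the phase space has null slices because every point of the lattice has
    positive mass. *)
Lemma symbol_ae_bound : exists S : R, [/\ 0 <= S,
  LpNorm (phase_measure R n) +oo%E sigma = S%:E &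
  forall m, {ae haarn, forall w, cabs (sigma (m, w)) <= S}].
Proof.
have [ms sfin] := Lsigma.
have s0 : (0 <= LpNorm (phase_measure R n) +oo%E sigma)%E by exact: Lnorm_ge0.
exists (fine (LpNorm (phase_measure R n) +oo%E sigma)); split.
- by rewrite fine_ge0.
- by rewrite fineK// ge0_fin_numE.
have : {ae phase_measure R n, forall z,
    ((cabs (sigma z))%:E <= LpNorm (phase_measure R n) +oo%E sigma)%E}.
  rewrite /LpNorm unlock phase_measure_gt0.
  have := ess_sup_ge (phase_measure R n) (abse \o (EFin \o (@cabs R \o sigma))).
  by apply: filterS => z /=; rewrite ger0_norm ?cabs_ge0.
move=> [N [mN N0 subN]] m.
exists (xsection N m); split; first exact: measurable_xsection.
  apply/eqP; rewrite eq_le measure_ge0 andbT -N0.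
  exact: (@term_le_integral R n (fun k => haarn (xsection N k)) m).
move=> w /= sw; rewrite xsectionE /=; apply: subN => /= H; apply: sw.
by rewrite -lee_fin fineK// ge0_fin_numE.
Qed.

Lemma cmeasurable_symbol m : cmeasurable (fun w => sigma (m, w)).
Proof.
have [[mr mi] _] := Lsigma.
by split; [exact: (measurableT_comp mr (measurable_pair1 m))|
           exact: (measurableT_comp mi (measurable_pair1 m))].
Qed.

End bounded_symbol.

Section localization_operator.
Context (R : realType) (n : nat).
Local Notation cZ := (countZ R n).
Local Notation haarn := (haar R n).
Variables (sigma : Zn n * Tn R n -> R[i]) (g1 g2 : Zn n -> R[i]).
Hypothesis Lsigma : Lp (phase_measure R n) +oo%E sigma.
Hypotheses (L1g1 : Lp cZ 1%E g1) (L1g2 : Lp cZ 1%E g2).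
Implicit Types f h : Zn n -> R[i].

Let lg1 : l2 g1. Proof. exact: summable_l2. Qed.

Definition slice f (m : Zn n) (w : Tn R n) : R[i] := sigma (m, w) * stft g1 f (m, w).

Definition slice_coef f (k m : Zn n) : R[i] :=
  cintegral haarn (fun w => slice f m w * cis (dot w k)).

Let cmeasurable_slice f m : l2 f -> cmeasurable (slice f m).
Proof.
by move=> lf; apply: cmeasurableM; [exact: cmeasurable_symbol|exact: cmeasurable_stft].
Qed.

(** The exponent 1 is used for integrability and the exponent 2 for the norm estimate. *)
Let slice_le (p : nat) f m (S : R) : l2 f -> 0 <= S ->
  {ae haarn, forall w, cabs (sigma (m, w)) <= S} ->
  (\int[haarn]_w (cabs (slice f m w) ^+ p)%:E <=
   (S ^+ p)%:E * \int[haarn]_w (cabs (stft g1 f (m, w)) ^+ p)%:E)%E.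
Proof.
move=> lf S0 Sm.
have mX (u : Tn R n -> R[i]) : cmeasurable u -> measurable_fun setT (fun w => (cabs (u w) ^+ p)%:E).
  by move=> mu; apply/measurable_EFinP; apply: measurable_funX; exact: measurable_cabs.
have mst := mX _ (cmeasurable_stft m lf lg1).
have p0 (u : Tn R n -> R[i]) w : (0 <= (cabs (u w) ^+ p)%:E)%E by rewrite lee_fin exprn_ge0// cabs_ge0.
have S0p : (0 <= (S ^+ p)%:E)%E by rewrite lee_fin exprn_ge0.
rewrite -ge0_integralZl//; last by move=> w _; exact: (p0 (fun w => stft g1 f (m, w))).
apply: ae_ge0_le_integral => //.
- by apply: (mX (slice f m)); exact: cmeasurable_slice.
- by move=> w _; rewrite mule_ge0//; exact: (p0 (fun w => stft g1 f (m, w))).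
- exact: emeasurable_funM.
apply: filterS Sm => w Sw _; rewrite -EFinM lee_fin /slice cabsM exprMn.
by rewrite ler_wpM2r ?exprn_ge0 ?cabs_ge0// lerXn2r ?nnegrE ?cabs_ge0.
Qed.

Let slice_bound f : l2 f -> exists2 C : R, 0 <= C &
  forall m, (\int[haarn]_w (cabs (slice f m w))%:E <= C%:E)%E.
Proof.
move=> lf; have [S [S0 _ Sm]] := symbol_ae_bound Lsigma.
have [r r0 rE] := l2norm_fin lf; have [s s0 sE] := l2norm_fin lg1.
exists (S * (r * s)) => [|m]; first by rewrite !mulr_ge0.
have := slice_le 1 lf S0 (Sm m).
under [X in (X <= _)%E -> _]eq_integral do rewrite expr1.
under [X in (_ <= _ * X)%E -> _]eq_integral do rewrite expr1.
rewrite expr1.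
move=> /le_trans; apply.
rewrite EFinM; apply: lee_wpmul2l => //.
apply: (@le_trans _ _ (\int[haarn]_w cst (r * s)%:E w)%E).
  apply: ge0_le_integral => //.
  - by move=> w _; rewrite lee_fin cabs_ge0.
  - by apply: measurable_ecabs; exact: cmeasurable_stft.
  - by move=> w _; rewrite EFinM -rE -sE; exact: cabs_stft_le.
by rewrite integral_cst// [X in (_ * X)%E]probability_setT mule1.
Qed.

Let Lp1_slice f m : l2 f -> Lp haarn 1%E (slice f m).
Proof.
move=> lf; split; first exact: cmeasurable_slice.
have [C _ /(_ m) mC] := slice_bound lf.
by rewrite LpNorm1E; apply: (le_lt_trans mC); rewrite ltry.
Qed.

Let Lp1_slice_char f k m : l2 f -> Lp haarn 1%E (fun w => slice f m w * cis (dot w k)).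
Proof.
move=> lf; under eq_fun do rewrite mulrC.
apply: (@Lp1_boundedM _ _ _ _ _ _ 1); last exact: Lp1_slice.
- exact: cmeasurable_char.
- by move=> w; rewrite cabs_cis.
Qed.

(** The window [g2] does not depend on the frequency variable, so it leaves the inner
    integral. *)
Lemma locopE f k : l2 f ->
  locop sigma g1 g2 f k = csum (fun m => g2 (k - m) * slice_coef f k m).
Proof.
move=> lf; apply: eq_cintegral => m.
rewrite /slice_coef -cintegralZ; last exact: Lp1_slice_char.
by apply: eq_cintegral => w; rewrite /slice /modulate /translate /cis; ring.
Qed.

Let Lp1_locop_summand f k : l2 f -> Lp cZ 1%E (fun m => g2 (k - m) * slice_coef f k m).
Proof.
move=> lf; have [C C0 mC] := slice_bound lf.
under eq_fun do rewrite mulrC.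
apply: (@Lp1_boundedM _ _ _ _ _ _ C); first exact: cmeasurable_Zn.
  move=> m; rewrite -lee_fin; apply: le_trans (mC m).
  apply: (le_trans (cabs_cintegral (Lp1_slice_char k m lf))).
  by under eq_integral do rewrite cabsM cabs_cis mulr1.
split; first exact: cmeasurable_Zn.
rewrite LpNorm1E (@integral_reflect R n (fun k => (cabs (g2 k))%:E)).
  by rewrite -LpNorm1E; case: L1g2.
by move=> j; rewrite lee_fin cabs_ge0.
Qed.

Let slice_coef_linear (a : R[i]) f h k m : l2 f -> l2 h ->
  slice_coef (fun k => a * f k + h k) k m = a * slice_coef f k m + slice_coef h k m.
Proof.
move=> lf lh; rewrite -[a * _]cintegralZ; last exact: Lp1_slice_char.
rewrite -[RHS]cintegralD; [|exact/Lp1Z/Lp1_slice_char|exact: Lp1_slice_char].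
by apply: eq_cintegral => w; rewrite /slice stft_linear//; ring.
Qed.

Lemma locop_linear (a : R[i]) f h : l2 f -> l2 h ->
  locop sigma g1 g2 (fun k => a * f k + h k) =
  (fun k => a * locop sigma g1 g2 f k + locop sigma g1 g2 h k).
Proof.
move=> lf lh; have lfh := l2_linear a lf lh.
apply/funext => k; rewrite !locopE//.
rewrite -[a * _]cintegralZ; last exact: Lp1_locop_summand.
rewrite -[RHS]cintegralD; [|exact/Lp1Z/Lp1_locop_summand|exact: Lp1_locop_summand].
by apply: eq_cintegral => m; rewrite slice_coef_linear//; ring.
Qed.

(** Cauchy-Schwarz in the time shift, Bessel's inequality for each slice, and Moyal's
    identity. *)
Lemma locop_norm2 f (S : R) : l2 f -> 0 <= S ->
  (forall m, {ae haarn, forall w, cabs (sigma (m, w)) <= S}) ->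
  (l2norm (locop sigma g1 g2 f) <= S%:E * (l2norm g1 * l2norm g2) * l2norm f)%E.
Proof.
move=> lf S0 Sm; apply: expe2_le; first exact: l2norm_ge0.
  by rewrite !mule_ge0 ?l2norm_ge0.
set q := (l2norm g2 ^+ 2)%E.
have q0 : (0 <= q)%E by exact: expe2_ge0.
have c0 (u : R) : (0 <= (u ^+ 2)%:E)%E by rewrite lee_fin sqr_ge0.
rewrite l2normE.
(* Cauchy-Schwarz in the time shift [m], for each [k] *)
apply: (@le_trans _ _ (\int[cZ]_k (q * \int[cZ]_m (cabs (slice_coef f k m) ^+ 2)%:E))%E).
  apply: ge0_le_integral => //.
  move=> k _; rewrite locopE//.
  have := @cauchy_schwarz _ _ R cZ (fun m => cabs (g2 (k - m)))
    (fun m => cabs (slice_coef f k m)) (measurable_Zn _) (measurable_Zn _).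
  rewrite (@integral_reflect R n (fun k => (cabs (g2 k) ^+ 2)%:E))// -l2normE -/q.
  apply: le_trans.
  rewrite [leLHS](_ : _ = ((cabs (csum (fun m => g2 (k - m) * slice_coef f k m)))%:E ^+ 2)%E); last first.
    by rewrite expe2 -EFinM.
  apply: lee_expe2; first by rewrite lee_fin cabs_ge0.
  apply: (le_trans (cabs_cintegral (Lp1_locop_summand k lf))).
  rewrite le_eqVlt; apply/orP; left; apply/eqP; apply: eq_integral => m _.
  by rewrite cabsM !ger0_norm ?cabs_ge0.
rewrite ge0_integralZl//; last by move=> k _; exact: integral_ge0.
(* Exchanging the sums makes Bessel's inequality applicable for each [m]. *)
rewrite [X in (q * X)%E](@tonelli_Zn R n _ _ (@lattice_counting R n)
  (fun k m => (cabs (slice_coef f k m) ^+ 2)%:E))//.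
apply: (@le_trans _ _ (q * \int[cZ]_m ((S ^+ 2)%:E *
    \int[haarn]_w (cabs (stft g1 f (m, w)) ^+ 2)%:E))%E).
  apply: lee_wpmul2l => //; apply: ge0_le_integral => //.
  - by move=> m _; exact: integral_ge0.
  - move=> m _; apply: le_trans (slice_le 2 lf S0 (Sm m)).
    exact: (bessel_char (Lp1_slice m lf)).
rewrite ge0_integralZl//; last by move=> m _; exact: integral_ge0.
rewrite moyal// /q !expe2M expr2 EFinM -!expe2.
rewrite le_eqVlt; apply/orP; left; apply/eqP.
rewrite muleCA -[RHS]muleA; congr (_ * _)%E.
by rewrite [RHS]muleAC [LHS]muleC [in LHS](muleC (l2norm f ^+ 2)%E).
Qed.

End localization_operator.

(** * The norm estimate *)

Theorem proposition4p2 (R : realType) (n : nat)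
  (g : Zn n -> R[i]) (hgS : schwartz g) (hg0 : exists k, g k <> 0)
  (sigma : Zn n * Tn R n -> R[i]) (hsigma : Lp (phase_measure R n) +oo%E sigma)
  (g1 g2 : Zn n -> R[i])
  (hg1 : modSpace g 1%E g1) (hg2 : modSpace g 1%E g2) :
  [/\ bounded_l2 (locop sigma g1 g2),
      (l2norm g ^+ 2 * opnorm_l2 (locop sigma g1 g2) <=
        LpNorm (phase_measure R n) +oo sigma * modNorm g 1 g1 * modNorm g 1 g2)%E &
      l2norm g = 1%E ->
      (opnorm_l2 (locop sigma g1 g2) <=
        LpNorm (phase_measure R n) +oo sigma * modNorm g 1 g1 * modNorm g 1 g2)%E].
Proof.
have L1 := modSpace1_summable hgS hg1 hg0.
have L2 := modSpace1_summable hgS hg2 hg0.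
have [S [S0 SE Sm]] := symbol_ae_bound hsigma.
have [r r0 rE] := l2norm_fin (summable_l2 L1).
have [s s0 sE] := l2norm_fin (summable_l2 L2).
set T := locop sigma g1 g2.
have Tle f : l2 f -> (l2norm (T f) <= S%:E * (l2norm g1 * l2norm g2) * l2norm f)%E.
  by move=> lf; exact: locop_norm2.
have S0e : (0 <= S%:E)%E by rewrite lee_fin.
have op : (opnorm_l2 T <= S%:E * (l2norm g1 * l2norm g2))%E.
  apply: ge_ereal_sup => _ [f [lf f1] <-]; apply: (le_trans (Tle f lf)).
  by rewrite -[leRHS]mule1; apply: lee_wpmul2l => //; rewrite !mule_ge0 ?l2norm_ge0.
have main : (l2norm g ^+ 2 * opnorm_l2 T <=
    LpNorm (phase_measure R n) +oo sigma * modNorm g 1 g1 * modNorm g 1 g2)%E.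
  apply: (@le_trans _ _ (l2norm g ^+ 2 * (S%:E * (l2norm g1 * l2norm g2)))%E).
    by apply: lee_wpmul2l => //; exact: expe2_ge0.
  rewrite muleCA expe2 (muleACA (l2norm g)) SE -[leRHS]muleA; apply: lee_wpmul2l => //.
  apply: lee_pmul; rewrite ?mule_ge0 ?l2norm_ge0//; exact: l2norm_window_le.
split=> // [|g1E]; last by move: main; rewrite g1E expe2 !mul1e.
split.
- move=> f lf; split; first exact: cmeasurable_Zn.
  apply: (le_lt_trans (Tle f lf)).
  by have [t _ ->] := l2norm_fin lf; rewrite rE sE -!EFinM ltry.
- by move=> a f h lf lh; exact: locop_linear.
- by exists (S * (r * s)) => f lf; rewrite !EFinM -rE -sE; exact: Tle.
Qed.
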